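(* Let $\mu$ be a symmetric Borel probability measure on $\mathbb{R}$. The following conditions are equivalent: (a) there exist $h>0$ and $\lambda\in[0,1)$ such that $\mu\in\mathcal{M}(h,\lambda)$; (b) there exists $C_p>0$ such that $\mu$ satisfies the convex Poincaré inequality with constant $C_p$; (c) there exists $C_\tau>0$ such that $\mu$ satisfies the convex exponential property $(\tau)$ with constant $C_\tau$. Moreover: if $\mu\in\mathcal{M}(h,\lambda)$ then $\mu$ satisfies the convex exponential property $(\tau)$ with constant $C_\tau=17h/(1-\lambda)^2$; if $\mu$ satisfies the convex exponential property $(\tau)$ with constant $C_\tau$ then it satisfies the convex Poincaré inequality with constant $C_p=\tfrac12 C_\tau^2$; and if $\mu$ satisfies the convex Poincaré inequality with constant $C_p$ then $\mu\in\mathcal{M}(\sqrt{8C_p},1/2)$.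
   Context: For $h>0$, $\lambda\in[0,1)$, $\mathcal{M}(h,\lambda)$ denotes the class of symmetric Borel probability measures $\mu$ on $\mathbb{R}$ such that $\mu([x+h,\infty))\le\lambda\,\mu([x,\infty))$ for all $x\ge0$. For a locally Lipschitz $f:\mathbb{R}\to\mathbb{R}$ (in particular a convex $f$), $f'(x):=\limsup_{h\to0}\frac{f(x+h)-f(x)}{h}$. A Borel probability measure $\mu$ on $\mathbb{R}$ satisfies the convex Poincaré inequality with constant $C_p$ if for every convex $f:\mathbb{R}\to\mathbb{R}$ with $f'$ bounded, $\mathrm{Var}_\mu f\le C_p\int (f')^2\,d\mu$. Let $\varphi_0(x)=\frac12x^2$ for $|x|\le1$ and $\varphi_0(x)=|x|-\frac12$ for $|x|>1$. The infimum convolution is $(f\,\square\,\varphi)(x)=\inf_{y}\{f(y)+\varphi(x-y)\}$. A Borel probability measure $\mu$ on $\mathbb{R}$ satisfies the convex exponential property $(\tau)$ with constant $C_\tau>0$ if for every convex $f:\mathbb{R}\to\mathbb{R}$ with $\inf f>-\infty$, $\left(\int e^{f\square\varphi}\,d\mu\right)\left(\int e^{-f}\,d\mu\right)\le1$, where $\varphi(x)=\varphi_0(x/C_\tau)$. *)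

(* Defs.v *)
From HB Require Import structures.
From mathcomp Require Import all_boot all_order all_algebra.
From mathcomp Require Import all_classical all_reals all_analysis.
Set Implicit Arguments. Unset Strict Implicit. Unset Printing Implicit Defensive.
Import Order.TTheory GRing.Theory Num.Theory.
Import numFieldNormedType.Exports.
Local Open Scope classical_set_scope.
Local Open Scope ring_scope.

Section Defs.
Variable R : realType.

(* Borel probability measures on R: probability over the canonical (Borel)
   measurable structure of R. *)
Definition symmetric_measure (mu : probability R R) :=
  forall A : set R, measurable A -> mu [set - x | x in A] = mu A.

Definition classM (h lam : R) (mu : probability R R) :=
  symmetric_measure mu /\
  forall x : R, 0 <= x ->
    (mu [set y : R | (x + h <= y)%R] <= lam%:E * mu [set y : R | (x <= y)%R])%E.

Definition convex_fun (f : R -> R) :=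
  forall x y t : R, 0 <= t <= 1 ->
    f (t * x + (1 - t) * y) <= t * f x + (1 - t) * f y.

(* f'(x) := limsup_{h -> 0} (f(x+h) - f(x))/h  (computed in extended reals,
   then projected to R; it is finite for convex f) *)
Definition dlimsup (f : R -> R) (x : R) : R :=
  fine (limf_esup (fun h : R => ((f (x + h) - f x) / h)%:E) (0 : R)^').

Definition Var (mu : probability R R) (f : R -> R) : \bar R :=
  if `[< mu.-integrable setT (fun x => (f x)%:E) >] then
    (\int[mu]_x (((f x - fine (\int[mu]_y (f y)%:E)) ^+ 2)%:E))%E
  else +oo%E.

Definition convex_poincare (mu : probability R R) (Cp : R) :=
  forall f : R -> R, convex_fun f ->
    (exists M : R, forall x, `|dlimsup f x| <= M) ->
    (Var mu f <= Cp%:E * \int[mu]_x ((dlimsup f x ^+ 2)%:E))%E.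

Definition phi0 (x : R) : R :=
  if `|x| <= 1 then x ^+ 2 / 2 else `|x| - 1 / 2.

Definition inf_conv (f phi : R -> R) (x : R) : R :=
  inf [set f y + phi (x - y) | y in [set: R]].

Definition convex_tau (mu : probability R R) (Ct : R) :=
  forall f : R -> R, convex_fun f ->
    has_lbound (range f) ->
    ((\int[mu]_x (expR (inf_conv f (fun z => phi0 (z / Ct)) x))%:E) *
     (\int[mu]_x (expR (- f x))%:E) <= 1)%E.

End Defs.

(* Main.v *)
Require Import Defs.
From HB Require Import structures.
From mathcomp Require Import all_boot all_order all_algebra.
From mathcomp Require Import all_classical all_reals all_analysis.
From mathcomp Require Import measurable_realfun ring lra.
Import Order.TTheory GRing.Theory Num.Theory.
Import numFieldNormedType.Exports.
Local Open Scope classical_set_scope.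
Local Open Scope ring_scope.

(** (a) => (c).  Put g = f [] phi, shifted so that g(0) = 0; then g is convex and
    1/C-Lipschitz.  Let T move every point towards 0 by at most h and let
    d = (g - g o T)_+.  Following the secant of g beyond x gives
    f >= g + psi with psi = (C d / h)^2 / 2 <= 1/2.  The even function
    G(x) = max (g x) (g (-x)) dominates |g|, is monotone in |x|, and
    G(x) - G(T x) <= max (d x) (d (-x)).  The tail condition says exactly that
    E (F o T) <= lam E F for F monotone in |x| with F 0 = 0; applied to
    F = 2 cosh G - 2 it yields the Hardy type bound
    E (2 cosh G - 2) <= 3/8 E psi.  Hence E e^g + E e^-f <= 2, and the product of
    the two terms is at most 1.

    (c) => (b).  For f >= 0 with subgradient p, Young's inequality gives
    (t f) [] phi >= t f - t^2 C^2 p^2 / 2 for small t, while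
    E e^(tf) E e^(-tf) >= 1 + t^2 Var f.  Together, Var f <= C^2/2 E (e^(tf) p^2),
    and t -> 0.  A general f is the limit of max f (-n).

    (b) => (a).  Test the Poincare inequality on the positive part of y - x. *)

(** * Convex functions on the line, their derivative, and the dual form of [phi0] *)

Section ConvexFunctions.
Context {R : realType}.
Implicit Types (f g : R -> R) (x y z t s c : R).

Lemma convex_three_points f x y z : convex_fun f -> x < y -> y < z ->
  (z - x) * f y <= (z - y) * f x + (y - x) * f z.
Proof.
move=> cf xy yz; have zx0 : 0 < z - x by lra.
have zxn0 : z - x != 0 by rewrite gt_eqF.
have h01 : 0 <= (z - y) / (z - x) <= 1.
  apply/andP; split; first by apply: divr_ge0; lra.
  by rewrite ler_pdivrMr //; lra.
have := cf x z ((z - y) / (z - x)) h01.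
have -> : (z - y) / (z - x) * x + (1 - (z - y) / (z - x)) * z = y by field.
rewrite -(ler_pM2l zx0).
suff -> : (z - x) * ((z - y) / (z - x) * f x + (1 - (z - y) / (z - x)) * f z)
  = (z - y) * f x + (y - x) * f z by [].
by field.
Qed.

Lemma convex_slope_left f x y z : convex_fun f -> x < y -> y < z ->
  (f y - f x) / (y - x) <= (f z - f x) / (z - x).
Proof.
move=> cf xy yz; have := convex_three_points f x y z cf xy yz.
rewrite ler_pdivrMr; last by lra.
rewrite mulrAC ler_pdivlMr; last by lra.
by lra.
Qed.

Lemma convex_slope_right f x y z : convex_fun f -> x < y -> y < z ->
  (f z - f x) / (z - x) <= (f z - f y) / (z - y).
Proof.
move=> cf xy yz; have := convex_three_points f x y z cf xy yz.
rewrite ler_pdivrMr; last by lra.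
rewrite mulrAC ler_pdivlMr; last by lra.
by lra.
Qed.

Lemma convex_slope_mid f x y z : convex_fun f -> x < y -> y < z ->
  (f y - f x) / (y - x) <= (f z - f y) / (z - y).
Proof.
move=> cf xy yz; apply: le_trans (convex_slope_left _ _ _ _ cf xy yz) _.
exact: convex_slope_right.
Qed.

(** Sublevel sets of a convex function are intervals, hence Borel. *)
Lemma convex_measurable f : convex_fun f -> measurable_fun setT f.
Proof.
move=> cf; apply: (measurability (@RGenOInfty.G R)); first exact: RGenOInfty.measurableE.
move=> _ [_ [a ->] <-]; rewrite setTI.
have -> : f @^-1` `]a, +oo[%classic = ~` [set x | f x <= a].
  apply/seteqP; split => x /=; rewrite in_itv /= andbT ltNge.
    by move/negP.
  by move/negP.
apply: measurableC; apply: is_interval_measurable => x y /= fx fy z /andP[xz zy].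
move: xz; rewrite le_eqVlt => /orP[/eqP <- //|xz].
move: zy; rewrite le_eqVlt => /orP[/eqP -> //|zy].
have := convex_three_points f x z y cf xz zy.
move=> h; rewrite leNgt; apply/negP => az.
have : (y - z) * f x <= (y - z) * a by rewrite ler_pM2l//; lra.
have : (z - x) * f y <= (z - x) * a by rewrite ler_pM2l//; lra.
have : (y - x) * a < (y - x) * f z by rewrite ltr_pM2l//; lra.
lra.
Qed.

(** Difference quotients of a convex function increase with the increment. Every punctured
    neighbourhood of 0 contains a negative increment whose quotient is at least the slope from [a],
    and on a small enough one all quotients stay below the slope to [b]. *)
Lemma dlimsup_bounds f x a b : convex_fun f -> a < x -> x < b ->
  (f x - f a) / (x - a) <= dlimsup f x <= (f b - f x) / (b - x).
Proof.
move=> cf ax xb; rewrite /dlimsup.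
set L := limf_esup _ _.
have L1 : (((f x - f a) / (x - a))%:E <= L)%E.
  apply: le_ereal_inf_tmp => _ [V /= FV <-].
  have [h [Vh h0 hlt]] : exists h, [/\ V h, h < 0 & a - x < h].
    move: FV; rewrite /dnbhs /within /= => /nbhs_ballP[e /= e0 eV].
    (* Halving keeps the increment strictly inside the ball and [x + h] strictly to the right of
       [a]. *)
    exists (- (Num.min (e / 2) ((x - a) / 2))).
    have m0 : 0 < Num.min (e / 2) ((x - a) / 2) by rewrite lt_min; apply/andP; split; lra.
    split; last 2 first.
    - by lra.
    - have : Num.min (e / 2) ((x - a) / 2) <= (x - a) / 2 by rewrite ge_min lexx orbT.
      by lra.
    apply: eV; last by rewrite oppr_eq0 gt_eqF.
    rewrite /ball /= sub0r opprK gtr0_norm //.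
    have : Num.min (e / 2) ((x - a) / 2) <= e / 2 by rewrite ge_min lexx.
    by lra.
  apply: le_trans (ereal_sup_ubound _); last by exists h.
  rewrite lee_fin.
  have := convex_slope_right f a (x + h) x cf.
  have -> : (f x - f (x + h)) / (x - (x + h)) = (f (x + h) - f x) / h.
    by rewrite opprD addrA subrr sub0r invrN mulrN -mulNr opprB.
  by apply; lra.
have L2 : (L <= ((f b - f x) / (b - x))%:E)%E.
  apply: ge_ereal_inf.
  have bx0 : 0 < b - x by lra.
  eexists.
    exists [set h | `|h| < b - x /\ h != 0] => //.
    rewrite /dnbhs /within /=; apply/nbhs_ballP; exists (b - x) => // h /=.
    by rewrite /ball /= sub0r normrN.
  apply: ge_ereal_sup => _ [h /= [hb hn0] <-]; rewrite lee_fin.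
  move: hn0; rewrite neq_lt => /orP[h0|h0].
    have := convex_slope_mid f (x + h) x b cf.
    have -> : (f x - f (x + h)) / (x - (x + h)) = (f (x + h) - f x) / h.
      by rewrite opprD addrA subrr sub0r invrN mulrN -mulNr opprB.
    by apply; lra.
  have := convex_slope_left f x (x + h) b cf.
  have -> : x + h - x = h by ring.
  apply; first lra.
  by move: hb; rewrite gtr0_norm //; lra.
(* Squeezed between two reals, the limsup is finite, so [fine] does not fall back on its default
   value. *)
have Lf : L \is a fin_num.
  by rewrite fin_numE; apply/andP; split; apply/eqP => E; move: L1 L2; rewrite E //= ?leeNy_eq.
by rewrite -!lee_fin fineK // L1 L2.
Qed.

Lemma dlimsup_ge_slope f x y : convex_fun f -> x < y ->
  f y - f x <= dlimsup f y * (y - x).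
Proof.
move=> cf xy; have /andP[+ _] := dlimsup_bounds f y x (y + 1) cf xy ltac:(lra).
by rewrite ler_pdivrMr //; lra.
Qed.

Lemma dlimsup_le_slope f x y : convex_fun f -> x < y ->
  dlimsup f x * (y - x) <= f y - f x.
Proof.
move=> cf xy; have /andP[_] := dlimsup_bounds f x (x - 1) y cf ltac:(lra) xy.
by rewrite ler_pdivlMr //; lra.
Qed.

(** The proof of (c) => (b) sees the derivative only through this inequality, its measurability and
    its bound. *)
Lemma dlimsup_subgradient f x y : convex_fun f ->
  f x + dlimsup f x * (y - x) <= f y.
Proof.
move=> cf; have [xy|yx|->] := ltrgtP x y; last by lra.
  by have := dlimsup_le_slope f x y cf xy; lra.
by have := dlimsup_ge_slope f y x cf yx; lra.
Qed.

Lemma dlimsup_nondecreasing f : convex_fun f -> nondecreasing_fun (dlimsup f).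
Proof.
move=> cf x y; rewrite le_eqVlt => /orP[/eqP -> //|xy].
have := dlimsup_le_slope f x y cf xy; have := dlimsup_ge_slope f x y cf xy.
move=> h1 h2; have := le_trans h2 h1; rewrite ler_pM2r //; lra.
Qed.

Lemma dlimsup_measurable f : convex_fun f -> measurable_fun setT (dlimsup f).
Proof.
by move=> cf; apply: nondecreasing_measurable => //; exact: dlimsup_nondecreasing.
Qed.

Lemma subgradient_lipschitz f p c : (forall x, `|p x| <= c) ->
  (forall x y, f x + p x * (y - x) <= f y) ->
  forall x y, `|f x - f y| <= c * `|x - y|.
Proof.
move=> pc sub.
suff H x y : f x - f y <= c * `|x - y|.
  by move=> x y; rewrite ler_norml; have := H x y; have := H y x; rewrite distrC; lra.
have := sub x y; have : p x * (x - y) <= c * `|x - y|.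
  apply: le_trans (ler_norm _) _; rewrite normrM ler_wpM2r //.
lra.
Qed.

(** [phi0] is the Legendre transform of s^2/2 on [-1, 1]. With [phi0_dual], where the supremum is
    attained, it becomes a maximum of affine functions of slope at most 1 in absolute value, which
    gives convexity and the Lipschitz bound. *)
Lemma phi0_young s y : `|s| <= 1 -> s * y - s ^+ 2 / 2 <= phi0 y.
Proof.
move=> s1; rewrite /phi0; case: ifPn => y1.
  by have := sqr_ge0 (y - s); rewrite sqrrB; lra.
rewrite -ltNge in y1.
have : s * y <= `|s| * `|y| by rewrite -normrM ler_norm.
have : s ^+ 2 = `|s| ^+ 2 by rewrite real_normK // num_real.
have := normr_ge0 s; nra.
Qed.

Lemma phi0_dual x : exists2 s, `|s| <= 1 & phi0 x = s * x - s ^+ 2 / 2.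
Proof.
rewrite /phi0; case: ifPn => x1; first by exists x => //; field.
exists (Num.sg x); first by rewrite normr_sg; case: (_ != _); rewrite ?lexx ?ler01.
have x0 : x != 0 by apply: contraNneq x1 => ->; rewrite normr0 ler01.
by rewrite -normrEsg sqr_sg x0.
Qed.

Lemma phi0_ge0 x : 0 <= phi0 x.
Proof. by have := @phi0_young 0 x; rewrite normr0 ler01 => /(_ isT); lra. Qed.

Lemma phi0_convex : convex_fun (@phi0 R).
Proof.
move=> x y t /andP[t0 t1]; have [s s1 ->] := phi0_dual (t * x + (1 - t) * y).
have : t * (s * x - s ^+ 2 / 2) <= t * phi0 x by rewrite ler_wpM2l // phi0_young.
have : (1 - t) * (s * y - s ^+ 2 / 2) <= (1 - t) * phi0 y.
  by rewrite ler_wpM2l ?phi0_young //; lra.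
lra.
Qed.

Lemma phi0_sub_le x y : phi0 x - phi0 y <= `|x - y|.
Proof.
have [s s1 ->] := phi0_dual x; have := phi0_young s y s1.
have : s * (x - y) <= `|x - y|.
  apply: le_trans (ler_norm _) _; rewrite normrM.
  by rewrite -[leRHS]mul1r ler_wpM2r.
lra.
Qed.

Lemma phi0_quad x : `|x| <= 1 -> phi0 x = x ^+ 2 / 2.
Proof. by rewrite /phi0 => ->. Qed.

End ConvexFunctions.

(** * Infimum convolution with the rescaled cost *)

Section InfimumConvolution.
Context {R : realType}.
Variables (f : R -> R) (C : R).
Hypotheses (C0 : 0 < C) (fb : has_lbound (range f)).
Let phi (z : R) := phi0 (z / C).
Let g := inf_conv f phi.

(** The real [inf] is meaningful only for nonempty sets bounded below; the lower bound of [f] and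
    [phi0 >= 0] provide this at every point. *)
Lemma inf_conv_has_inf x :
  has_inf [set f y + phi (x - y) | y in [set: R]].
Proof.
split; first by exists (f 0 + phi (x - 0)), 0.
have [m fm] := fb; exists m => _ [y _ <-].
have : m <= f y by apply: fm; exists y.
have := phi0_ge0 ((x - y) / C); rewrite /phi; lra.
Qed.

Lemma inf_conv_le x y : g x <= f y + phi (x - y).
Proof. by apply: ge_inf; [case: (inf_conv_has_inf x) | exists y]. Qed.

Lemma inf_conv_ge x m : (forall y, m <= f y + phi (x - y)) -> m <= g x.
Proof.
move=> H; apply: lb_le_inf; first by case: (inf_conv_has_inf x).
by move=> _ [y _ <-].
Qed.

Lemma inf_conv_approx x e : 0 < e -> exists y, f y + phi (x - y) < g x + e.
Proof.
by move=> e0; have [_ [y _ <-] H] := inf_adherent e0 (inf_conv_has_inf x); exists y.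
Qed.

(** The function f y + phi (x - y) is jointly convex in x and y, and so its infimum over y is convex
    in x. Near-minimisers stand in for minimisers, which may fail to exist. *)
Lemma inf_conv_convex : convex_fun f -> convex_fun g.
Proof.
move=> cf x y t t01; apply/ler_addgt0Pr => e e0.
have [a Ha] := inf_conv_approx x e e0; have [b Hb] := inf_conv_approx y e e0.
have := inf_conv_le (t * x + (1 - t) * y) (t * a + (1 - t) * b).
have := cf a b t t01; have := phi0_convex ((x - a) / C) ((y - b) / C) t t01.
have -> : t * ((x - a) / C) + (1 - t) * ((y - b) / C) =
  (t * x + (1 - t) * y - (t * a + (1 - t) * b)) / C by ring.
move: Ha Hb; rewrite /phi => Ha Hb.
move/andP: t01 => [t0 t1].
have : t * (f a + phi0 ((x - a) / C)) <= t * (g x + e).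
  by rewrite ler_wpM2l //; lra.
have : (1 - t) * (f b + phi0 ((y - b) / C)) <= (1 - t) * (g y + e).
  by rewrite ler_wpM2l //; lra.
lra.
Qed.

Lemma inf_conv_sub_le x y : g x - g y <= `|x - y| / C.
Proof.
suff : g x - `|x - y| / C <= g y by lra.
apply: inf_conv_ge => a; have := inf_conv_le x a.
have := phi0_sub_le ((x - a) / C) ((y - a) / C).
have -> : (x - a) / C - (y - a) / C = (x - y) / C by ring.
rewrite normrM [`|C^-1|]gtr0_norm ?invr_gt0 // /phi; lra.
Qed.

Lemma inf_conv_norm_sub_le x y : `|g x - g y| <= `|x - y| / C.
Proof.
rewrite ler_norml; have := inf_conv_sub_le x y; have := inf_conv_sub_le y x.
by rewrite [`|y - x|]distrC; lra.
Qed.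

End InfimumConvolution.

(** * Pointwise inequalities for exponentials *)

Section ExponentialInequalities.
Context {R : realType}.
Implicit Types a b x y : R.

(** This is 2 cosh x - 2, the square of 2 sinh (x/2). It vanishes at 0 and increases with |x|, as
    the contraction [mean_soft_le] demands. *)
Definition cosh2 x : R := expR x + expR (- x) - 2.

Lemma cosh2_sqr x : cosh2 x = (expR (x / 2) - expR (- (x / 2))) ^+ 2.
Proof.
have -> : cosh2 x = expR (x / 2 + x / 2) + expR (- (x / 2) - x / 2) - 2.
  by rewrite /cosh2; congr (expR _ + expR _ - _); field.
rewrite !expRD; have := expRxMexpNx_1 (x / 2); nra.
Qed.

Lemma cosh2_ge0 x : 0 <= cosh2 x.
Proof. by rewrite cosh2_sqr sqr_ge0. Qed.

Lemma cosh2N x : cosh2 (- x) = cosh2 x.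
Proof. by rewrite /cosh2 opprK; ring. Qed.

Lemma cosh20 : cosh2 0 = 0.
Proof. by rewrite /cosh2 oppr0 expR0; ring. Qed.

Lemma cosh2_norm x : cosh2 `|x| = cosh2 x.
Proof. by have [|] := ger0P x => // _; rewrite cosh2N. Qed.

Lemma cosh2_le_norm a b : `|a| <= b -> cosh2 a <= cosh2 b.
Proof.
move=> ab; rewrite -cosh2_norm !cosh2_sqr ler_sqr ?nnegrE.
- by apply: lerB; rewrite ler_expR; lra.
- by rewrite subr_ge0 ler_expR; have := normr_ge0 a; lra.
- by rewrite subr_ge0 ler_expR; have := normr_ge0 a; lra.
Qed.

(** The left side is a partial sum of the exponential series, whose terms are nonnegative here. *)
Lemma expR_ge_quadratic x : 0 <= x -> 1 + x + x ^+ 2 / 2 <= expR x.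
Proof.
move=> x0; have <- : series (exp_coeff x) 3 = 1 + x + x ^+ 2 / 2.
  rewrite /series /= !big_nat_recr //= big_nil /exp_coeff /= expr0 expr1 add0r.
  by rewrite !divr1.
apply: nondecreasing_cvgn_le; last exact: is_cvg_series_exp_coeff.
apply/nondecreasing_series => n _ _; exact: exp_coeff_ge0.
Qed.

(** After taking square roots the claim is y <= 2 sinh (y/2) for y = |x|. *)
Lemma sqr_le_cosh2 x : x ^+ 2 <= cosh2 x.
Proof.
rewrite -cosh2_norm -[x ^+ 2]real_normK ?num_real // cosh2_sqr.
move: (normr_ge0 x); set y := `|x| => y0.
have v0 : 0 <= y / 2 by lra.
suff : y <= expR (y / 2) - expR (- (y / 2)).
  by move=> H; rewrite ler_sqr ?nnegrE //; lra.
have E1 := expRxMexpNx_1 (y / 2).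
have p1 := expR_gt0 (y / 2); have p2 := expR_gt0 (- (y / 2)).
have E2 := expR_ge_quadratic (y / 2) v0.
set X := expR (y / 2) in E1 E2 p1 *; set Y := expR _ in E1 p2 *.
set v := y / 2 in E2 v0 *.
have -> : y = 2 * v by rewrite /v; field.
(* Since (1 + v + v^2/2)(1 - v + v^2/2) = 1 + v^4/4 >= 1 and e^v is at least the first factor,
   e^(-v) is at most the second. *)
have : Y <= 1 - v + v ^+ 2 / 2.
  have q : 0 < 1 - v + v ^+ 2 / 2 by nra.
  rewrite -(ler_pM2l p1) E1.
  apply: (@le_trans _ _ ((1 + v + v ^+ 2 / 2) * (1 - v + v ^+ 2 / 2))).
    have -> : (1 + v + v ^+ 2 / 2) * (1 - v + v ^+ 2 / 2) = 1 + (v ^+ 2) ^+ 2 / 4 by field.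
    by have := sqr_ge0 (v ^+ 2); lra.
  by rewrite ler_pM2r.
lra.
Qed.

(** Write [cosh2] as u^2 with u = 2 sinh (x/2). The increment of u from b to a is at most (a - b)
    e^(a/2), and e^a <= 2 + cosh2 a. Splitting the square with weight [al] leaves a factor close to
    1 on [cosh2 b], which the contraction by [lam] can absorb. *)
Lemma cosh2_step a b al : 0 < al -> 0 <= b -> b <= a ->
  cosh2 a <= (1 + al) * cosh2 b + (1 + al^-1) * (a - b) ^+ 2 * (2 + cosh2 a).
Proof.
move=> al0 b0 ba.
have a2 : expR (a / 2) ^+ 2 <= 2 + cosh2 a.
  have -> : cosh2 a = expR (a / 2 + a / 2) + expR (- a) - 2.
    by rewrite /cosh2; congr (expR _ + _ - _); field.
  by rewrite expRD; have := expR_gt0 (- a); lra.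
have inc : expR (a / 2) - expR (- (a / 2)) - (expR (b / 2) - expR (- (b / 2)))
    <= (a - b) * expR (a / 2).
  have E : 1 - expR (- ((a - b) / 2)) <= (a - b) / 2.
    by have := expR_ge1Dx (- ((a - b) / 2)); lra.
  have e1 : expR (b / 2) = expR (a / 2) * expR (- ((a - b) / 2)).
    by rewrite -expRD; congr expR; field.
  have e2 : expR (- (a / 2)) = expR (- (b / 2)) * expR (- ((a - b) / 2)).
    by rewrite -expRD; congr expR; field.
  rewrite e1 e2.
  have p1 := expR_gt0 (a / 2); have p2 := expR_gt0 (- (b / 2)).
  have : expR (- (b / 2)) <= expR (a / 2) by rewrite ler_expR; lra.
  set X := expR (a / 2) in p1 *; set Y := expR (- (b / 2)) in p2 *.
  set Z := expR _ in E *; move=> YX.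
  have H1 : X * (1 - Z) <= X * ((a - b) / 2) by rewrite ler_pM2l.
  have H2 : Y * (1 - Z) <= Y * ((a - b) / 2) by rewrite ler_pM2l.
  have H3 : Y * ((a - b) / 2) <= X * ((a - b) / 2) by rewrite ler_wpM2r //; lra.
  lra.
have ub0 : 0 <= expR (b / 2) - expR (- (b / 2)) by rewrite subr_ge0 ler_expR; lra.
have uab : expR (b / 2) - expR (- (b / 2)) <= expR (a / 2) - expR (- (a / 2)).
  by apply: lerB; rewrite ler_expR; lra.
rewrite (cosh2_sqr b) {1}(cosh2_sqr a).
set ua := expR (a / 2) - _ in inc uab *; set ub := expR (b / 2) - _ in inc ub0 uab *.
have H1 : (ua - ub) ^+ 2 <= (a - b) ^+ 2 * (2 + cosh2 a).
  apply: (@le_trans _ _ (((a - b) * expR (a / 2)) ^+ 2)).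
    rewrite ler_sqr ?nnegrE //; first lra.
    by apply: mulr_ge0; [lra | exact: expR_ge0].
  by rewrite exprMn ler_wpM2l // sqr_ge0.
(* Weighted form of (x + y)^2 <= (1 + al) x^2 + (1 + 1/al) y^2, obtained from a square. *)
have H2 : ua ^+ 2 <= (1 + al) * ub ^+ 2 + (1 + al^-1) * (ua - ub) ^+ 2.
  have : 0 <= al^-1 * (al * ub - (ua - ub)) ^+ 2.
    by apply: mulr_ge0; [rewrite invr_ge0 ltW | exact: sqr_ge0].
  have -> : al^-1 * (al * ub - (ua - ub)) ^+ 2 =
    al * ub ^+ 2 - 2 * ub * (ua - ub) + al^-1 * (ua - ub) ^+ 2.
    by field; rewrite gt_eqF.
  lra.
apply: (le_trans H2); rewrite lerD2l -mulrA ler_wpM2l //.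
have : 0 < al^-1 by rewrite invr_gt0.
lra.
Qed.

(** The gain psi lowers e^(-f) to at most e^(-g)(1 - 2 psi/3), while e^g + e^(-g) <= 2 + cosh2 G.
    The gain is at least 2 psi/3 times 3/4 - cosh2 G, that is, psi/2 up to an error of cosh2 G /
    3. *)
Lemma exp_sum_le (f g G psi : R) : `|g| <= G -> 0 <= psi -> psi <= 1 / 2 ->
  g + psi <= f -> expR g + expR (- f) + psi / 2 <= 2 + 4 / 3 * cosh2 G.
Proof.
move=> gG p0 p1 gf.
have G0 : 0 <= G by apply: le_trans gG.
have c1 := cosh2_le_norm g G gG.
have fle : expR (- f) <= expR (- g) * expR (- psi) by rewrite -expRD ler_expR; lra.
(* Here e^(-psi) <= 1/(1 + psi), and (1 + psi)(1 - 2 psi/3) >= 1 exactly when 0 <= psi <= 1/2. *)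
have ple : expR (- psi) <= 1 - 2 / 3 * psi.
  have := expR_ge1Dx psi; have := expRxMexpNx_1 psi.
  have := expR_gt0 psi; have := expR_gt0 (- psi); nra.
have gle : expR (- G) <= expR (- g).
  by rewrite ler_expR; have := ler_norm g; lra.
(* With Y = e^(-G) <= 1, cosh2 G = (1 - Y)^2 / Y >= (1 - Y)^2 >= (1 - Y) - 1/4. *)
have Gle : 3 / 4 - cosh2 G <= expR (- G).
  have : expR (- G) <= 1 by rewrite -expR0 ler_expR; lra.
  have := expRxMexpNx_1 G; have := expR_gt0 G; have := expR_gt0 (- G).
  rewrite /cosh2; set X := expR G; set Y := expR (- G) => Y0 X0 XY Y1.
  have -> : X = Y^-1 by apply: (mulIf (lt0r_neq0 Y0)); rewrite XY mulVf // gt_eqF.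
  have : Y^-1 + Y - 2 = Y^-1 * (1 - Y) ^+ 2 by field; rewrite gt_eqF.
  have : 1 * (1 - Y) ^+ 2 <= Y^-1 * (1 - Y) ^+ 2.
    by rewrite ler_wpM2r ?sqr_ge0 // invf_ge1.
  have := sqr_ge0 (1 - Y - 1 / 2).
  by move=> H1 H2 ->; move: H1 H2; set Z := Y^-1 * _; lra.
have e0 := expR_gt0 (- g).
have : expR (- g) * expR (- psi) <= expR (- g) * (1 - 2 / 3 * psi) by rewrite ler_pM2l.
have : psi * (3 / 4 - cosh2 G) <= psi * expR (- g) by rewrite ler_wpM2l //; lra.
have : psi * cosh2 G <= 1 / 2 * cosh2 G by rewrite ler_wpM2r // cosh2_ge0.
move: c1; rewrite {1}/cosh2; lra.
Qed.

End ExponentialInequalities.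

(** * Expectations of nonnegative functions *)

Section Expectation.
Context {R : realType} (mu : probability R R).
Implicit Types (f g : R -> R) (k : R).

Let meas f := measurable_fun [set: R] f.

Lemma mean_le f g : (forall x, 0 <= f x) -> meas f -> meas g ->
  (forall x, f x <= g x) ->
  (\int[mu]_x (f x)%:E <= \int[mu]_x (g x)%:E)%E.
Proof.
move=> f0 mf mg fg; apply: ge0_le_integral => //.
- by move=> x _; rewrite lee_fin.
- exact/measurable_EFinP.
- exact/measurable_EFinP.
- by move=> x _; rewrite lee_fin.
Qed.

Lemma meanD f g : (forall x, 0 <= f x) -> meas f ->
  (forall x, 0 <= g x) -> meas g ->
  (\int[mu]_x (f x + g x)%:E = \int[mu]_x (f x)%:E + \int[mu]_x (g x)%:E)%E.
Proof.
move=> f0 mf g0 mg.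
under eq_integral do rewrite EFinD.
rewrite ge0_integralD //.
- by move=> x _; rewrite lee_fin.
- exact/measurable_EFinP.
- by move=> x _; rewrite lee_fin.
- exact/measurable_EFinP.
Qed.

Lemma meanZ k f : 0 <= k -> (forall x, 0 <= f x) -> meas f ->
  (\int[mu]_x (k * f x)%:E = k%:E * \int[mu]_x (f x)%:E)%E.
Proof.
move=> k0 f0 mf.
under eq_integral do rewrite EFinM.
rewrite ge0_integralZl //.
- exact/measurable_EFinP.
- by move=> x _; rewrite lee_fin.
Qed.

Lemma mean_cst k : (\int[mu]_x k%:E = k%:E)%E.
Proof. by rewrite integral_cst // [X in (_ * X)%E](_ : _ = 1%E) ?mule1 //; exact: probability_setT. Qed.

Lemma mean_ge0 f : (forall x, 0 <= f x) -> (0 <= \int[mu]_x (f x)%:E)%E.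
Proof. by move=> f0; apply: integral_ge0 => x _; rewrite lee_fin. Qed.

Lemma mean_bounded_fin f k : (forall x, 0 <= f x) -> meas f ->
  (forall x, f x <= k) -> (\int[mu]_x (f x)%:E)%E \is a fin_num.
Proof.
move=> f0 mf fk; rewrite ge0_fin_numE ?mean_ge0 //.
apply: (@le_lt_trans _ _ (\int[mu]_x k%:E)%E); last by rewrite mean_cst ltry.
by apply: mean_le => //; exact: measurable_cst.
Qed.

Lemma mean_oppr f : symmetric_measure mu -> (forall x, 0 <= f x) -> meas f ->
  (\int[mu]_x (f (- x))%:E = \int[mu]_x (f x)%:E)%E.
Proof.
move=> sym f0 mf.
have mN : measurable_fun [set: R] (-%R : R -> R) by exact: oppr_measurable.
transitivity (\int[pushforward mu (-%R : R -> R)]_x (f x)%:E)%E.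
  rewrite ge0_integral_pushforward //; first exact/measurable_EFinP.
  by move=> x _; rewrite lee_fin.
apply: eq_measure_integral.
move=> A mA _; rewrite /pushforward -[RHS]sym //; congr (mu _).
apply/seteqP; split => x /=; first by exists (- x) => //; rewrite opprK.
by case=> y Ay <-; rewrite opprK.
Qed.

End Expectation.

(** * Soft thresholding, the map T that moves points towards 0 *)

Section SoftThreshold.
Context {R : realType}.
Implicit Types (h x a : R).

(** For a > 0 the preimage of {|x| >= a} is {|x| >= a + h}, the set that the tail condition
    controls. *)
Definition soft h x : R :=
  if h < x then x - h else if x < - h then x + h else 0.

Lemma softN h x : 0 <= h -> soft h (- x) = - soft h x.
Proof.
by move=> h0; rewrite /soft; do ?[case: ltrP => ?]; lra.
Qed.

Lemma norm_soft h x : 0 <= h -> `|soft h x| = Num.max (`|x| - h) 0.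
Proof.
move=> h0; rewrite /soft; case: ifPn => H1.
  rewrite !gtr0_norm; [by rewrite max_l //; lra | lra | lra].
case: ifPn => H2; first by rewrite !ltr0_norm; [rewrite max_l; lra | lra | lra].
rewrite normr0 max_r // subr_le0 ler_norml; lra.
Qed.

Lemma soft_measurable h : 0 <= h -> measurable_fun [set: R] (soft h).
Proof.
move=> h0; apply: nondecreasing_measurable => // x y xy; rewrite /soft.
by do ?[case: ltrP => ?]; lra.
Qed.

Lemma soft_sub_le h x : 0 <= h -> `|x - soft h x| <= h.
Proof.
move=> h0; rewrite /soft ler_norml; do ?[case: ltrP => ?]; lra.
Qed.

End SoftThreshold.

(** * The tail condition as a contraction of expectations *)

Section Contraction.
Context {R : realType} (mu : probability R R) (h lam : R).
Hypotheses (h0 : 0 < h) (lam0 : 0 <= lam) (muM : classM h lam mu).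

Lemma measure_norm_ge a : 0 < a ->
  (mu [set x : R | (a <= `|x|)%R] = mu [set x : R | (a <= x)%R] + mu [set x : R | (a <= x)%R])%E.
Proof.
move=> a0; have [sym _] := muM.
have mA : measurable [set x : R | (a <= x)%R].
  by have := measurable_itv (`[a, +oo[ : interval R); rewrite set_itvcy.
have -> : [set x : R | (a <= `|x|)%R] =
   [set x : R | (a <= x)%R] `|` [set - x | x in [set x : R | (a <= x)%R]].
  apply/seteqP; split => x /=.
    rewrite ler_normr => /orP[ax|ax]; [by left | right; exists (- x) => //; exact: opprK].
  by case=> [ax|[y ay <-]]; rewrite ler_normr ?opprK ?ax ?ay ?orbT.
rewrite measureU //.
- by congr (_ + _)%E; exact: sym.
- have -> : [set - x | x in [set x : R | (a <= x)%R]] = [set x : R | (x <= - a)%R].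
    apply/seteqP; split => x /=; first by case=> y ay <-; lra.
    by move=> xa; exists (- x); [lra | exact: opprK].
  by have := measurable_itv (`]-oo, - a] : interval R); rewrite set_itvNyc.
- apply/seteqP; split => x //= [ax [y ay yx]]; lra.
Qed.

Lemma tail_ge a : 0 < a ->
  (mu [set x : R | (a + h <= `|x|)%R] <= lam%:E * mu [set x : R | (a <= `|x|)%R])%E.
Proof.
move=> a0; rewrite (measure_norm_ge a) // (measure_norm_ge (a + h)) ?addr_gt0 //.
have [_ tl] := muM; rewrite ge0_muleDr //.
by apply: leeD; apply: tl; exact: ltW.
Qed.

Lemma measurable_norm_ge a : measurable [set x : R | (a <= `|x|)%R].
Proof.
rewrite [X in measurable X](_ : _ = setT `&` (Num.norm : R -> R) @^-1` `[a, +oo[).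
  by apply: (@normr_measurable R setT) => //; exact: measurable_itv.
by apply/seteqP; split => x /=; rewrite in_itv /= andbT //; case.
Qed.

Lemma measurable_norm_gt a : measurable [set x : R | (a < `|x|)%R].
Proof.
rewrite [X in measurable X](_ : _ = setT `&` (Num.norm : R -> R) @^-1` `]a, +oo[).
  by apply: (@normr_measurable R setT) => //; exact: measurable_itv.
by apply/seteqP; split => x /=; rewrite in_itv /= andbT //; case.
Qed.

(** The open tails are increasing unions of closed tails at a + 1/(n+1), so continuity of the
    measure from below transfers [tail_ge]. Starting from positive levels also covers a = 0, where
    [tail_ge] does not apply. *)
Lemma tail_gt a : 0 <= a ->
  (mu [set x : R | (a + h < `|x|)%R] <= lam%:E * mu [set x : R | (a < `|x|)%R])%E.
Proof.
move=> a0.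
pose F n := [set x : R | (a + n.+1%:R^-1 + h <= `|x|)%R].
have FU : \bigcup_n F n = [set x : R | (a + h < `|x|)%R].
  apply/seteqP; split => x /=.
    case=> n _; rewrite /F /=; have : 0 < n.+1%:R^-1 :> R by rewrite invr_gt0.
    by move: (n.+1%:R^-1) => e; lra.
  move=> ax; have /ltr_add_invr[n Hn] : 0 < `|x| - (a + h) by lra.
  by exists n => //; rewrite /F /=; move: Hn; move: (n.+1%:R^-1) => e; lra.
have : mu \o F @ \oo --> mu (\bigcup_n F n).
  apply: nondecreasing_cvg_mu.
  - by move=> n; exact: measurable_norm_ge.
  - by rewrite FU; exact: measurable_norm_gt.
  - move=> m n mn; apply/subsetPset => x; rewrite /F /=.
    have : n.+1%:R^-1 <= m.+1%:R^-1 :> R by rewrite lef_pV2 ?posrE // ler_nat ltnS.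
    by move: (n.+1%:R^-1) (m.+1%:R^-1) => e e'; lra.
rewrite FU => cvgF; rewrite -(cvg_lim _ cvgF) //; apply: lime_le.
  by apply/cvg_ex; eexists; exact: cvgF.
apply: nearW => n /=.
have i0 : 0 < n.+1%:R^-1 :> R by rewrite invr_gt0.
apply: le_trans (tail_ge _ _) _; first by rewrite ltr_wpDl.
rewrite lee_wpmul2l ?lee_fin //; apply: le_measure; rewrite ?inE.
- exact: measurable_norm_ge.
- exact: measurable_norm_gt.
- by move=> x /=; move: i0; move: (n.+1%:R^-1) => e; lra.
Qed.

(** Let a be the infimum of |x| over S. If a belongs to S then S = {|x| >= a}, and a > 0 because 0
    is not in S; otherwise S = {|x| > a}. The two tail estimates treat these cases. *)
Lemma contraction_set (S : set R) : ~ S 0 ->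
  (forall x y, S x -> `|x| <= `|y| -> S y) ->
  (mu (soft h @^-1` S) <= lam%:E * mu S)%E.
Proof.
move=> S0 Sup; have h0' := ltW h0.
have [->|/set0P[x0 Sx0]] := eqVneq S set0.
  by rewrite preimage_set0 measure0 mule0.
pose A := [set `|x| | x in S].
have Ainf : has_inf A.
  by split; [exists `|x0|, x0 | exists 0 => _ [y _ <-]].
set a := inf A.
have a0 : 0 <= a by apply: lb_le_inf; [case: Ainf | move=> _ [y _ <-]].
have Sa x : a < `|x| -> S x.
  move=> ax; have e0 : 0 < `|x| - a by lra.
  have [_ [y Sy <-] yx] := inf_adherent e0 Ainf.
  by apply: Sup Sy _; move: yx; rewrite -/a; lra.
have aS x : S x -> a <= `|x|.
  by move=> Sx; apply: ge_inf; [case: Ainf | exists x].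
have [SA|SA] := pselect (S a).
  have a1 : 0 < a by rewrite lt_neqAle a0 andbT; apply/eqP => E; apply: S0; rewrite E.
  have SE : S = [set x | a <= `|x|].
    apply/seteqP; split => x /=; first exact: aS.
    by move=> ax; apply: Sup SA _; rewrite ger0_norm.
  have -> : soft h @^-1` S = [set x | a + h <= `|x|].
    rewrite SE; apply/seteqP; split => x /=; rewrite norm_soft // le_max.
      by move=> /orP[]; lra.
    by move=> H; apply/orP; left; lra.
  by rewrite SE; exact: tail_ge.
have SE : S = [set x | a < `|x|].
  apply/seteqP; split => x /=; last exact: Sa.
  move=> Sx; rewrite lt_neqAle aS // andbT; apply/eqP => E; apply: SA.
  by apply: Sup Sx _; rewrite E normr_id.
have -> : soft h @^-1` S = [set x | a + h < `|x|].
  rewrite SE; apply/seteqP; split => x /=; rewrite norm_soft // lt_max.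
    by move=> /orP[]; lra.
  by move=> H; apply/orP; left; lra.
by rewrite SE; exact: tail_gt.
Qed.

(** Layer-cake formula: E F is the integral over t >= 0 of mu {F > t}, and each such superlevel set
    satisfies the hypotheses of [contraction_set]. *)
Lemma mean_soft_le (F : R -> R) : measurable_fun setT F -> F 0 = 0 ->
  (forall x y, `|x| <= `|y| -> F x <= F y) ->
  (\int[mu]_x (F (soft h x))%:E <= lam%:E * \int[mu]_x (F x)%:E)%E.
Proof.
move=> mF F0 Fup; have h0' := ltW h0.
have Fge0 x : 0 <= F x by rewrite -F0; apply: Fup; rewrite normr0.
have mFs : measurable_fun setT (F \o soft h).
  by apply: measurableT_comp => //; exact: soft_measurable.
pose X : {RV mu >-> R} := mfun_Sub (mem_set mF).
pose Y : {RV mu >-> R} := mfun_Sub (mem_set mFs).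
have EX : (\int[mu]_x (F x)%:E = 'E_mu[X])%E by rewrite unlock.
have EY : (\int[mu]_x (F (soft h x))%:E = 'E_mu[Y])%E by rewrite unlock.
rewrite EX EY !ge0_expectation_ccdf //; last by move=> x; exact: Fge0.
have mc (Z : {RV mu >-> R}) : measurable_fun (`[0%R, +oo[%classic : set R) (ccdf Z).
  by apply: measurable_funTS; exact: ccdf_measurable.
rewrite -ge0_integralZl //; last exact: (mc X).
apply: ge0_le_integral => //.
- exact: (mc Y).
- exact: (measurable_funeM lam%:E (mc X)).
- move=> t /=; rewrite in_itv /= andbT => t0; apply: (@contraction_set (F @^-1` `]t, +oo[)).
    by rewrite /= in_itv /= andbT F0; lra.
  by move=> x y /=; rewrite !in_itv /= !andbT => tx /Fup; exact: lt_le_trans.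
Qed.

End Contraction.

(** * From the tail condition to the property (tau) *)

Lemma sum_le2_mule_le1 {R : realType} (a b : \bar R) :
  (0 <= a -> 0 <= b -> a + b <= 2%:E -> a * b <= 1)%E.
Proof.
case: a b => [a| |] [b| |] //; rewrite -?EFinD -?EFinM ?lee_fin => a0 b0 ab.
by have := sqr_ge0 (a - b); nra.
Qed.

Section TailsToTau.
Context {R : realType} (mu : probability R R) (h lam : R).
Hypotheses (h0 : 0 < h) (lam0 : 0 <= lam) (lam1 : lam < 1) (muM : classM h lam mu).
Let C : R := 17 * h / (1 - lam) ^+ 2.
(** This is C / h, so a function with Lipschitz constant 1/C changes by at most 1/k over a distance
    h. *)
Let k : R := 17 / (1 - lam) ^+ 2.

(** F stands for f and g for its infimum convolution, both shifted by the same constant so that g 0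
    = 0. The hypothesis [gF] keeps from the infimum only that g lies below each of its
    competitors. *)
Variables (F g : R -> R).
Hypotheses (mF : measurable_fun setT F) (cg : convex_fun g) (g0 : g 0 = 0).
Hypothesis (g_lip : forall x y, `|g x - g y| <= `|x - y| / C).
Hypothesis (gF : forall x y, g y <= F x + phi0 ((y - x) / C)).

Let T := soft h.
Let d (x : R) : R := Num.max 0 (g x - g (T x)).
Let psi (x : R) : R := (k * d x) ^+ 2 / 2.
Let G (x : R) : R := Num.max (g x) (g (- x)).

Let q0 : 0 < 1 - lam. Proof. by rewrite subr_gt0. Qed.
Let h0' : 0 <= h. Proof. exact: ltW. Qed.
Let k0 : 0 < k. Proof. by rewrite divr_gt0 ?exprn_gt0. Qed.
Let CE : C = k * h. Proof. by rewrite /C /k; ring. Qed.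
Let C0 : 0 < C. Proof. by rewrite CE mulr_gt0. Qed.

Let d_ge0 x : 0 <= d x. Proof. by rewrite le_max lexx. Qed.

(** This bound keeps the test point of [le_psi] within the quadratic range of [phi0]. *)
Let kd_le1 x : k * d x <= 1.
Proof.
rewrite mulrC -ler_pdivlMr // ge_max; apply/andP; split.
  by rewrite divr_ge0 // ltW.
apply: (le_trans (ler_norm _)); apply: (le_trans (g_lip _ _)).
rewrite ler_pdivrMr //; have -> : 1 / k * C = h by rewrite CE; field; rewrite gt_eqF.
exact: soft_sub_le.
Qed.

Let psi_ge0 x : 0 <= psi x.
Proof. by rewrite /psi divr_ge0 // sqr_ge0. Qed.

Let psi_le x : psi x <= 1 / 2.
Proof.
have H : (k * d x) ^+ 2 <= 1.
  by rewrite expr_le1 // mulr_ge0 //; exact: ltW.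
by rewrite /psi; lra.
Qed.

(** Put v = x - T x. By convexity, beyond x the graph of g lies above the secant through T x and x,
    so g (x + t v) >= g x + t d x. Then [gF] at y = x + t v gives F x >= g x + t d x - (t v / C)^2 /
    2. *)
Let le_psi x : g x + psi x <= F x.
Proof.
have := gF x x; rewrite subrr mul0r phi0_quad ?normr0 // expr0n mul0r addr0 => gFx.
have [dx|dx] := leP (g x - g (T x)) 0.
  by rewrite /psi /d max_l // mulr0 expr0n mul0r addr0.
have dE : d x = g x - g (T x) by rewrite /d max_r // ltW.
(* As |v| / C <= 1/k, the gain is at least t d - (t/k)^2 / 2, which is maximal at t = k^2 d with
   value psi. *)
pose v := x - T x; pose t := k ^+ 2 * d x.
have t0 : 0 <= t by rewrite mulr_ge0 ?sqr_ge0.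
have vh : `|v| <= h by exact: soft_sub_le.
have tv : `|t * v / C| <= k * d x.
  rewrite normrM normrM (ger0_norm t0) [`|C^-1|]gtr0_norm ?invr_gt0 //.
  rewrite ler_pdivrMr // CE.
  have -> : k * d x * (k * h) = t * h by rewrite /t; ring.
  by rewrite ler_wpM2l.
have := gF x (x + t * v); rewrite [x + _]addrC addrK phi0_quad; last first.
  exact: le_trans tv (kd_le1 x).
have : (t * v / C) ^+ 2 <= (k * d x) ^+ 2.
  by rewrite -[leLHS]real_normK ?num_real // ler_sqr ?nnegrE // mulr_ge0 // ltW.
have : g x + t * d x <= g (t * v + x).
  have t1 : 0 < 1 + t by lra.
  (* x is the mean of T x and x + t v with weights t/(1+t) and 1/(1+t). *)
  have H : 0 <= t / (1 + t) <= 1.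
    apply/andP; split; first by rewrite divr_ge0 // ltW.
    by rewrite ler_pdivrMr //; lra.
  have := cg (T x) (t * v + x) _ H.
  have -> : t / (1 + t) * T x + (1 - t / (1 + t)) * (t * v + x) = x.
    by rewrite /v; field; rewrite gt_eqF.
  rewrite -(ler_pM2l t1).
  have -> : (1 + t) * (t / (1 + t) * g (T x) + (1 - t / (1 + t)) * g (t * v + x))
    = t * g (T x) + g (t * v + x) by field; rewrite gt_eqF.
  rewrite dE; lra.
have -> : t * d x = (k * d x) ^+ 2 by rewrite /t; ring.
rewrite /psi; lra.
Qed.

Let g_sum x : 0 <= g x + g (- x).
Proof.
have := cg x (- x) (1 / 2) ltac:(lra).
have -> : 1 / 2 * x + (1 - 1 / 2) * - x = 0 by field.
rewrite g0; lra.
Qed.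

Let G_ge x : `|g x| <= G x.
Proof.
by rewrite ler_norml /G le_max lexx andbT lerNl le_max; have := g_sum x;
  move=> ?; apply/orP; right; lra.
Qed.

Let G_ge0 x : 0 <= G x.
Proof. by apply: le_trans (G_ge x). Qed.

Let GN x : G (- x) = G x. Proof. by rewrite /G opprK maxC. Qed.

Let G0 : G 0 = 0. Proof. by rewrite /G oppr0 g0 maxxx. Qed.

Let G_scale s y : 0 <= s <= 1 -> g (s * y) <= G y.
Proof.
move=> s01; have := cg y 0 s s01; rewrite mulr0 addr0 g0 mulr0 addr0 => H.
apply: (le_trans H); apply: (@le_trans _ _ (s * G y)).
  by rewrite ler_wpM2l ?le_max ?lexx //; case/andP: s01.
by rewrite -[leRHS]mul1r ler_wpM2r //; case/andP: s01.
Qed.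

(** Such an x is s y or s (-y) with s in [0, 1], and g (s y) <= s g y because g is convex with g 0 =
    0. *)
Let g_le_G x y : `|x| <= `|y| -> g x <= G y.
Proof.
have [->|yn0] := eqVneq y 0.
  by rewrite normr0 normr_le0 => /eqP ->; rewrite g0 G0.
move=> xy; have [s] : exists s, 0 <= s <= 1 /\ (x = s * y \/ x = s * - y).
  exists (`|x| / `|y|); split.
    apply/andP; split; first exact: divr_ge0.
    by rewrite ler_pdivrMr ?normr_gt0 // mul1r.
  have [x0|x0] := ger0P x; have [y0|y0] := ltrP 0 y; rewrite ?(gtr0_norm y0) ?(ler0_norm y0).
  - by left; rewrite divfK.
  - by right; rewrite divfK // oppr_eq0.
  - by right; rewrite mulrN mulNr mulNr opprK divfK.
  - by left; rewrite invrN mulrNN divfK.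
by case=> s01 [->|->]; [exact: G_scale | rewrite -GN; exact: G_scale].
Qed.

Let G_mono x y : `|x| <= `|y| -> G x <= G y.
Proof. by move=> xy; rewrite {1}/G ge_max !g_le_G // normrN. Qed.

Let norm_T x : `|T x| <= `|x|.
Proof. by rewrite norm_soft // ge_max normr_ge0 andbT lerBlDr lerDl. Qed.

Let G_step x : G x - G (T x) <= Num.max (d x) (d (- x)).
Proof.
rewrite lerBlDr {1}/G ge_max; apply/andP; split.
  apply: (@le_trans _ _ (d x + g (T x))).
    by rewrite -lerBlDr /d le_max lexx orbT.
  by apply: lerD; rewrite le_max lexx.
apply: (@le_trans _ _ (d (- x) + g (T (- x)))).
  by rewrite -lerBlDr /d le_max lexx orbT.
apply: lerD; first by rewrite le_max lexx orbT.
by rewrite /T softN // le_max lexx orbT.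
Qed.

(** Truncation at N makes the expectation finite, so that it can be moved across an inequality;
    [mean_cosh2G] lets N tend to infinity. *)
Let c (N x : R) := cosh2 (Num.min (G x) N).

(** This is [cosh2_step] with al = (1 - lam)/2 between the truncated values of G at T x and x, whose
    difference is at most D. *)
Let c_step (N x : R) : 0 <= N ->
  c N x <= (1 + (1 - lam) / 2) * c N (T x) +
     ((1 - lam) / 24 * (psi x + psi (- x)) + (1 - lam) / 96 * c N x).
Proof.
move=> N0; set q := 1 - lam.
have b0 : 0 <= Num.min (G (T x)) N by rewrite le_min G_ge0.
have ba : Num.min (G (T x)) N <= Num.min (G x) N.
  by rewrite le_min2 // G_mono // norm_T.
have qq0 : 0 < q by exact: q0.
have q2 : 0 < q / 2 by rewrite divr_gt0.
have := cosh2_step _ _ _ q2 b0 ba; rewrite -/(c N x) -/(c N (T x)) => H.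
apply: (le_trans H); rewrite lerD2l.
set D := Num.max (d x) (d (- x)).
have D0 : 0 <= D by rewrite le_max d_ge0.
have aD : Num.min (G x) N - Num.min (G (T x)) N <= D.
  rewrite lerBlDr ge_min; have := G_step x; rewrite -/D.
  have [|] := leP (G (T x)) N => H1 H2; apply/orP; [left | right]; lra.
have aD2 : (Num.min (G x) N - Num.min (G (T x)) N) ^+ 2 <= D ^+ 2.
  by rewrite ler_sqr ?nnegrE // subr_ge0.
have kD : (k * D) ^+ 2 <= 1.
  rewrite expr_le1 //; first by rewrite /D maxEle; case: ifP => _; exact: kd_le1.
  by rewrite mulr_ge0 //; exact: ltW.
have kD2 : (k * D) ^+ 2 <= 2 * (psi x + psi (- x)).
  rewrite /psi; have := sqr_ge0 (k * d x); have := sqr_ge0 (k * d (- x)).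
  by rewrite /D maxEle; case: ifP => _; lra.
have c0 : 0 <= c N x by exact: cosh2_ge0.
have q1 : q <= 1 by rewrite /q; have := lam0; lra.
have i0 : 0 < 1 + (q / 2)^-1 by rewrite ltr_wpDl ?invr_gt0.
apply: (@le_trans _ _ ((1 + (q / 2)^-1) * D ^+ 2 * (2 + c N x))).
  by apply: ler_wpM2r; [exact: addr_ge0 | apply: ler_wpM2l => //; exact: ltW].
have -> : (1 + (q / 2)^-1) * D ^+ 2 = (q ^+ 4 + 2 * q ^+ 3) / 289 * (k * D) ^+ 2.
  by rewrite /k -/q; field; rewrite gt_eqF.
(* The constant 17 is fixed here: q^4 + 2 q^3 <= 3 q for q in [0, 1], and 17^2 = 289 exceeds 3 * 96
   = 288. *)
have qle : (q ^+ 4 + 2 * q ^+ 3) / 289 <= q / 96.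
  have q3 : q ^+ 3 <= q.
    rewrite exprSr -[leRHS]mul1r; apply: ler_wpM2r; first exact: ltW.
    by rewrite expr_le1 // ltW.
  have q4 : q ^+ 4 <= q.
    rewrite exprSr -[leRHS]mul1r; apply: ler_wpM2r; first exact: ltW.
    by rewrite expr_le1 // ltW.
  by lra.
have p0 := psi_ge0 x; have p0' := psi_ge0 (- x).
set m := (k * D) ^+ 2 in kD kD2 *; have m0 : 0 <= m by exact: sqr_ge0.
apply: (@le_trans _ _ (q / 96 * (m * (2 + c N x)))).
  by rewrite -(mulrA _ m); apply: ler_wpM2r => //; rewrite mulr_ge0 // addr_ge0.
(* The two bounds on m serve different terms: m <= 2 (psi x + psi (- x)) for the constant 2, and m
   <= 1 for c N x. *)
have : m * c N x <= 1 * c N x by rewrite ler_wpM2r.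
move=> H1; have : q / 96 * (m * (2 + c N x)) <= q / 96 * (4 * (psi x + psi (- x)) + c N x).
  by apply: ler_wpM2l; [rewrite divr_ge0 // ltW | lra].
lra.
Qed.

Let mg : measurable_fun setT g. Proof. exact: convex_measurable. Qed.
Let mgN (u : R -> R) : measurable_fun setT u -> measurable_fun setT (fun x : R => u (- x)).
Proof. by move=> mu'; apply: (measurableT_comp mu'); exact: oppr_measurable. Qed.
Let mT : measurable_fun setT T. Proof. exact: soft_measurable. Qed.
Let md : measurable_fun setT d.
Proof.
apply: measurable_maxr; first exact: measurable_cst.
by apply: measurable_funB => //; apply: measurableT_comp.
Qed.
Let mpsi : measurable_fun setT psi.
Proof.
apply: measurable_funM; last exact: measurable_cst.
by apply: measurable_funX; apply: measurable_funM => //; exact: measurable_cst.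
Qed.
Let mG : measurable_fun setT G.
Proof. by apply: measurable_maxr => //; exact: mgN. Qed.
Let mcosh2 (u : R -> R) : measurable_fun setT u -> measurable_fun setT (cosh2 \o u).
Proof.
move=> mu'; apply: measurable_funB; last exact: measurable_cst.
apply: measurable_funD; apply: (measurableT_comp (@measurable_expR R)) => //.
by apply: (measurableT_comp (@oppr_measurable R setT)).
Qed.
Let mc N : measurable_fun setT (c N).
Proof.
by apply: mcosh2; apply: measurable_minr => //; exact: measurable_cst.
Qed.

Let c_ge0 N x : 0 <= c N x. Proof. exact: cosh2_ge0. Qed.

Let p := (\int[mu]_x (psi x)%:E)%E.
Let p_fin : p \is a fin_num. Proof. exact: mean_bounded_fin psi_le. Qed.

(** Integrating [c_step], symmetry turns psi x + psi (- x) into 2 p and the contraction puts a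
    factor lam on the first term. What remains on the right of E c has total factor below 1 and is
    absorbed. *)
Let mean_c N : 0 <= N -> (\int[mu]_x (c N x)%:E <= (3 / 8)%:E * p)%E.
Proof.
move=> N0.
have cfin : (\int[mu]_x (c N x)%:E)%E \is a fin_num.
  apply: (@mean_bounded_fin _ _ _ (cosh2 N)) => // x; apply: cosh2_le_norm.
  by rewrite ger0_norm ?ge_min ?lexx ?orbT // le_min G_ge0.
have cT : (\int[mu]_x (c N (T x))%:E <= lam%:E * \int[mu]_x (c N x)%:E)%E.
  apply: mean_soft_le => //.
    by rewrite /c G0 min_l // cosh20.
  move=> x y xy; apply: cosh2_le_norm; rewrite ger0_norm ?le_min ?G_ge0 //.
  by rewrite -le_min le_min2 // G_mono.
have sym : symmetric_measure mu by case: muM.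
have q24 : 0 <= (1 - lam) / 24 by rewrite divr_ge0 // ltW.
have q96 : 0 <= (1 - lam) / 96 by rewrite divr_ge0 // ltW.
have q2 : 0 <= 1 + (1 - lam) / 2 by rewrite addr_ge0 // divr_ge0 // ltW.
have mcT : measurable_fun setT (c N \o T) by apply: measurableT_comp.
have H : (\int[mu]_x (c N x)%:E <= (1 + (1 - lam) / 2)%:E * \int[mu]_x (c N (T x))%:E +
    (((1 - lam) / 24)%:E * (p + p) + ((1 - lam) / 96)%:E * \int[mu]_x (c N x)%:E))%E.
  have mpN := mgN _ mpsi.
  have -> : (p + p = \int[mu]_x (psi x + psi (- x))%:E)%E by rewrite meanD // mean_oppr.
  rewrite -!meanZ //; last 2 first.
  - by move=> x; rewrite addr_ge0.
  - exact: measurable_funD.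
  have m1 : measurable_fun setT (fun x => (1 - lam) / 24 * (psi x + psi (- x))).
    by apply: measurable_funM; [exact: measurable_cst | exact: measurable_funD].
  have m2 : measurable_fun setT (fun x => (1 - lam) / 96 * c N x).
    by apply: measurable_funM => //; exact: measurable_cst.
  have m3 : measurable_fun setT (fun x => (1 + (1 - lam) / 2) * c N (T x)).
    by apply: measurable_funM => //; exact: measurable_cst.
  have n1 x : 0 <= (1 - lam) / 24 * (psi x + psi (- x)) by rewrite mulr_ge0 // addr_ge0.
  have n2 x : 0 <= (1 - lam) / 96 * c N x by rewrite mulr_ge0.
  have n3 x : 0 <= (1 + (1 - lam) / 2) * c N (T x) by rewrite mulr_ge0.
  rewrite -meanD // -meanD //; last 2 first.
  - by move=> x; rewrite addr_ge0.
  - exact: measurable_funD.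
  apply: mean_le => //; first by apply: measurable_funD => //; exact: measurable_funD.
  by move=> x; exact: c_step.
have {H} := le_trans H (leeD (lee_wpmul2l _ cT) (lexx _)).
rewrite lee_fin => /(_ q2).
rewrite -(fineK cfin) -(fineK p_fin) -?EFinM -?EFinD -?EFinM -?EFinD !lee_fin.
have p0 : 0 <= fine p by rewrite fine_ge0 // mean_ge0.
have e0 : 0 <= fine (\int[mu]_x (c N x)%:E)%E by rewrite fine_ge0 // mean_ge0.
set e := fine (integral _ _ _) in e0 *; set r := fine p in p0 * => H.
(* With q = 1 - lam, (1 + q/2)(1 - q) <= 1 - q/2. *)
have H2 : (1 + (1 - lam) / 2) * (lam * e) <= (1 - (1 - lam) / 2) * e.
  rewrite mulrA ler_wpM2r //; have := sqr_ge0 (1 - lam); have := lam1; lra.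
(* 47/96 is 1/2 - 1/96, and 1/12 is twice 1/24. *)
have : (1 - lam) * (47 / 96 * e) <= (1 - lam) * (r / 12) by lra.
rewrite ler_pM2l //; lra.
Qed.

Let mean_cosh2G : (\int[mu]_x (cosh2 (G x))%:E <= (3 / 8)%:E * p)%E.
Proof.
have cv : (\int[mu]_x (c n%:R x)%:E @[n --> \oo] --> \int[mu]_x (cosh2 (G x))%:E)%E.
  have H x : (c n%:R x)%:E @[n --> \oo] --> (cosh2 (G x))%:E.
    apply: cvg_near_cst; near=> n; congr (cosh2 _)%:E; apply: min_l.
    by near: n; exact: nbhs_infty_ger.
  have -> : (\int[mu]_x (cosh2 (G x))%:E = \int[mu]_x limn (fun n => (c n%:R x)%:E))%E.
    by apply: eq_integral => x _; rewrite (cvg_lim _ (H x)).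
  apply: cvg_monotone_convergence => //.
  - by move=> n; exact/measurable_EFinP.
  - by move=> n x _; rewrite lee_fin.
  - move=> x _ m n mn; rewrite lee_fin; apply: cosh2_le_norm.
    rewrite ger0_norm ?le_min2 ?ler_nat // le_min G_ge0 //=.
rewrite -(cvg_lim _ cv) //; apply: lime_le; first by apply/cvg_ex; eexists; exact: cv.
by apply: nearW => n; exact: mean_c.
Unshelve. all: by end_near. Qed.

(** The expectation of [exp_sum_le]: the error 4/3 times 3/8 of p equals the gain p/2. As p is
    finite, both cancel. *)
Lemma mean_exp_sum_le2 :
  (\int[mu]_x (expR (g x))%:E + \int[mu]_x (expR (- F x))%:E <= 2%:E)%E.
Proof.
have me1 : measurable_fun setT (fun x => expR (g x)).
  by apply: (measurableT_comp (@measurable_expR R)).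
have me2 : measurable_fun setT (fun x => expR (- F x)).
  apply: (measurableT_comp (@measurable_expR R)).
  by apply: (measurableT_comp (@oppr_measurable R setT)).
have m1 : measurable_fun setT (fun x => expR (g x) + expR (- F x)) by exact: measurable_funD.
have m2 : measurable_fun setT (fun x => 1 / 2 * psi x).
  by apply: measurable_funM => //; exact: measurable_cst.
have m3 : measurable_fun setT (fun x => 4 / 3 * cosh2 (G x)).
  by apply: measurable_funM; [exact: measurable_cst | exact: mcosh2].
have H : (\int[mu]_x (expR (g x))%:E + \int[mu]_x (expR (- F x))%:E + (1 / 2)%:E * p
    <= 2%:E + (4 / 3)%:E * \int[mu]_x (cosh2 (G x))%:E)%E.
  rewrite -meanZ // -meanZ //; last 2 first.
  - by move=> x; exact: cosh2_ge0.
  - exact: mcosh2.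
  have e1 x : 0 <= expR (g x) by exact: expR_ge0.
  have e2 x : 0 <= expR (- F x) by exact: expR_ge0.
  have e12 x : 0 <= expR (g x) + expR (- F x) by exact: addr_ge0.
  have n2 x : 0 <= 1 / 2 * psi x by exact: mulr_ge0.
  have n3 x : 0 <= 4 / 3 * cosh2 (G x) by rewrite mulr_ge0 // cosh2_ge0.
  rewrite -(mean_cst mu 2) -meanD // -meanD // -meanD //.
  apply: mean_le => //.
  - by move=> x; exact: addr_ge0.
  - exact: measurable_funD.
  - by apply: measurable_funD => //; exact: measurable_cst.
  - move=> x; have := exp_sum_le _ _ _ _ (G_ge x) (psi_ge0 x) (psi_le x) (le_psi x).
    lra.
have H2 : ((4 / 3)%:E * \int[mu]_x (cosh2 (G x))%:E <= (1 / 2)%:E * p)%E.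
  apply: le_trans (lee_wpmul2l _ mean_cosh2G) _; first by rewrite lee_fin; lra.
  by rewrite -(fineK p_fin) -!EFinM lee_fin; lra.
have := le_trans H (leeD (lexx _) H2).
by rewrite leeD2rE // fin_numM.
Qed.

End TailsToTau.

Lemma classM_convex_tau (R : realType) (mu : probability R R) (h lam : R) :
  0 < h -> 0 <= lam < 1 -> classM h lam mu ->
  convex_tau mu (17 * h / (1 - lam) ^+ 2).
Proof.
move=> h0 /andP[lam0 lam1] muM f cf fb.
set C := 17 * h / (1 - lam) ^+ 2; set g := inf_conv _ _.
have C0 : 0 < C by rewrite divr_gt0 ?exprn_gt0 ?subr_gt0 // mulr_gt0.
have cg : convex_fun g by exact: inf_conv_convex.
have mf := convex_measurable _ cf; have mg := convex_measurable _ cg.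
have me (u : R -> R) : measurable_fun setT u -> measurable_fun setT (fun x => expR (u x)).
  by move=> mu'; apply: (measurableT_comp (@measurable_expR R)).
have : (\int[mu]_x (expR (g x - g 0))%:E +
  \int[mu]_x (expR (- (f x - g 0)))%:E <= 2%:E)%E.
  apply: (@mean_exp_sum_le2 _ _ h lam) => //.
  - by apply: measurable_funB => //; exact: measurable_cst.
  - by move=> x y t t01; have := cg x y t t01; lra.
  - by rewrite subrr.
  - move=> x y; have -> : g x - g 0 - (g y - g 0) = g x - g y by ring.
    exact: inf_conv_norm_sub_le.
  - by move=> x y; have := inf_conv_le f C fb y x; rewrite -/g; lra.
have e1 x : expR (g x - g 0) = expR (- g 0) * expR (g x) by rewrite -expRD addrC.
have e2 x : expR (- (f x - g 0)) = expR (g 0) * expR (- f x) by rewrite -expRD opprB.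
under eq_integral do rewrite e1.
under [in X in (_ + X)%E]eq_integral do rewrite e2.
have mef : measurable_fun setT (fun x => expR (- f x)).
  by apply: me; exact: (measurableT_comp (@oppr_measurable R setT)).
have e0 (u : R -> R) x : 0 <= expR (u x) by exact: expR_ge0.
rewrite (meanZ mu _ (fun x => expR (g x))) ?expR_ge0 //; last exact: me.
rewrite (meanZ mu _ (fun x => expR (- f x))) ?expR_ge0 //.
move=> /sum_le2_mule_le1; rewrite !mule_ge0 ?lee_fin ?expR_ge0 ?mean_ge0 //.
move=> /(_ isT isT).
(* The shift by g 0 contributes e^(- g 0) and e^(g 0), which cancel in the product. *)
by rewrite muleACA -EFinM mulrC expRxMexpNx_1 mul1e.
Qed.

(** * From the Poincare inequality to the tail condition *)

Lemma measurable_ge (R : realType) (a : R) : measurable [set y : R | (a <= y)%R].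
Proof. by have := measurable_itv (`[a, +oo[ : interval R); rewrite set_itvcy. Qed.

Lemma measurable_le (R : realType) (a : R) : measurable [set y : R | (y <= a)%R].
Proof. by have := measurable_itv (`]-oo, a] : interval R); rewrite set_itvNyc. Qed.

Lemma symmetric_measure_le_half (R : realType) (mu : probability R R) (x : R) :
  symmetric_measure mu -> 0 <= x -> ((1 / 2)%:E <= mu [set y : R | (y <= x)%R])%E.
Proof.
move=> sym x0.
have m1 := measurable_le _ (0 : R); have m2 := measurable_ge _ (0 : R).
have E : mu [set y : R | (0 <= y)%R] = mu [set y : R | (y <= 0)%R].
  rewrite -(sym _ m1); congr (mu _); apply/seteqP; split => y /=.
    by move=> y0; exists (- y); [lra | exact: opprK].
  by case=> z z0 <-; lra.
have : (1%:E <= mu [set y : R | (y <= 0)%R] + mu [set y : R | (y <= 0)%R])%E.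
  rewrite -{2}E -(@probability_setT _ _ _ mu).
  apply: le_trans (measureU2 _ _ _) => //.
  rewrite le_measure ?inE //; first exact: measurableU.
  by move=> y _ /=; have [|/ltW] := leP y 0; [left | right].
have : (mu [set y : R | (y <= 0)%R] <= mu [set y : R | (y <= x)%R])%E.
  rewrite le_measure ?inE //; first exact: measurable_le.
  by move=> y /= y0; lra.
rewrite -(fineK (fin_num_measure mu _ m1)) -(fineK (fin_num_measure mu _ (measurable_le _ x))).
by rewrite -EFinD !lee_fin; lra.
Qed.

Lemma mean_indic (R : realType) (mu : probability R R) (A : set R) :
  measurable A -> (\int[mu]_x (\1_A x : R)%:E = mu A)%E.
Proof. by move=> mA; rewrite integral_indic // setIT. Qed.

(** For f = (y - x)_+ the derivative is 0 left of x and at most 1 elsewhere, so the right side is at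
    most Cp mu(A). With m the mean of f, the variance is at least m^2 mu(L), where f = 0, plus (h -
    m)_+^2 mu(B), where f >= h. *)
Lemma convex_poincare_classM (R : realType) (mu : probability R R) (Cp : R) :
  symmetric_measure mu -> 0 < Cp -> convex_poincare mu Cp ->
  classM (Num.sqrt (8 * Cp)) (1 / 2) mu.
Proof.
move=> sym Cp0 P; split => // x x0.
set h := Num.sqrt (8 * Cp).
have h2 : h ^+ 2 = 8 * Cp by rewrite sqr_sqrtr // mulr_ge0 // ltW.
have h0 : 0 < h by rewrite sqrtr_gt0 mulr_gt0.
pose f (y : R) : R := Num.max (y - x) 0.
have cf : convex_fun f.
  move=> a b t /andP[t0 t1]; rewrite /f ge_max; apply/andP; split.
    have : t * (a - x) <= t * f a by rewrite ler_wpM2l // le_max lexx.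
    have : (1 - t) * (b - x) <= (1 - t) * f b.
      by apply: ler_wpM2l; [lra | rewrite le_max lexx].
    by rewrite /f; lra.
  by rewrite addr_ge0 // mulr_ge0 ?le_max ?lexx ?orbT //; lra.
have mf := convex_measurable _ cf.
have d0 y : 0 <= dlimsup f y.
  have := dlimsup_ge_slope f (y - 1) y cf ltac:(lra).
  have -> : y - (y - 1) = 1 by ring.
  rewrite mulr1 => H; apply: le_trans H; rewrite subr_ge0 /f ge_max.
  by rewrite !le_max lexx orbT andbT; apply/orP; left; lra.
have d1 y : dlimsup f y <= 1.
  have := dlimsup_le_slope f y (y + 1) cf ltac:(lra).
  have -> : y + 1 - y = 1 by ring.
  rewrite mulr1 => H; apply: (le_trans H); rewrite lerBlDr /f ge_max.
  by apply/andP; split; rewrite maxEle; case: ifPn; lra.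
have dx y : y < x -> dlimsup f y = 0.
  move=> yx; apply/eqP; rewrite eq_le d0 andbT.
  have := dlimsup_le_slope f y x cf yx.
  rewrite /f subrr maxxx max_r; last lra.
  by rewrite subrr pmulr_lle0 // subr_gt0.
pose A := [set y : R | (x <= y)%R]; pose B := [set y : R | (x + h <= y)%R].
pose L := [set y : R | (y <= x)%R].
have mA : measurable A by exact: measurable_ge.
have mB : measurable B by exact: measurable_ge.
have mL : measurable L by exact: measurable_le.
have dle : (\int[mu]_y (dlimsup f y ^+ 2)%:E <= mu A)%E.
  rewrite -mean_indic //; apply: mean_le.
  - by move=> y; exact: sqr_ge0.
  - by apply: measurable_funX; exact: dlimsup_measurable.
  - exact: measurable_indic.
  - move=> y; rewrite indicE; have [xy|xy] := leP x y.
      by rewrite mem_set //= expr_le1.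
    by rewrite dx // expr0n /= ler0n.
have dM : exists M : R, forall y, `|dlimsup f y| <= M.
  by exists 1 => y; rewrite ger0_norm.
have fA := fin_num_measure mu _ mA; have fB := fin_num_measure mu _ mB.
have fL := fin_num_measure mu _ mL.
have := le_trans (P f cf dM) (lee_wpmul2l _ dle); rewrite lee_fin => /(_ (ltW Cp0)).
(* The value +oo of [Var] for a non-integrable f contradicts the finite right side. *)
rewrite /Var; case: ifPn => [_|_]; last first.
  by rewrite leye_eq -(fineK fA) -EFinM.
set m := fine _ => VA.
pose b := Num.max (h - m) 0.
have b0 : 0 <= b by rewrite le_max lexx orbT.
have m1 (E : set R) (k : R) : measurable E ->
    measurable_fun setT (fun y : R => k * \1_E y).
  by move=> mE; apply: measurable_funM; [exact: measurable_cst | exact: measurable_indic].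
have V2 : ((m ^+ 2)%:E * mu L + (b ^+ 2)%:E * mu B <=
    \int[mu]_y ((f y - m) ^+ 2)%:E)%E.
  have i0 (E : set R) y : (0 : R) <= \1_E y by rewrite indicE ler0n.
  have mi (E : set R) : measurable E -> measurable_fun setT (\1_E : R -> R).
    exact: measurable_indic.
  rewrite -(mean_indic _ mu L) // -(mean_indic _ mu B) // -!meanZ ?sqr_ge0 //; try exact: mi.
  have n1 (E : set R) (k : R) y : 0 <= k ^+ 2 * \1_E y by rewrite mulr_ge0 // sqr_ge0.
  rewrite -meanD //; try exact: m1.
  apply: mean_le => //.
  - by move=> y; rewrite addr_ge0.
  - by apply: measurable_funD; exact: m1.
  - by apply: measurable_funX; apply: measurable_funB => //; exact: measurable_cst.
  - move=> y; rewrite !indicE; have [yx|xy] := leP y x.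
      rewrite mem_set //= memNset /=; last by rewrite /B /=; lra.
      by rewrite /f max_r; lra.
    rewrite memNset /=; last by rewrite /L /=; lra.
    have [xhy|yxh] := leP (x + h) y; last first.
      rewrite memNset /=; last by rewrite /B /=; lra.
      by have := sqr_ge0 (f y - m); lra.
    rewrite mem_set //= mulr0 add0r mulr1.
    rewrite /b; have [hm|hm] := leP (h - m) 0; first by rewrite expr0n sqr_ge0.
    have fy : h <= f y by rewrite /f le_max; apply/orP; left; lra.
    by rewrite ler_sqr ?nnegrE; lra.
have B1 : fine (mu B) <= 1.
  by rewrite -lee_fin fineK // probability_le1.
have B0 : 0 <= fine (mu B) by rewrite fine_ge0 // measure_ge0.
have Lh := symmetric_measure_le_half _ _ _ sym x0; rewrite -/L in Lh.
have := le_trans V2 VA; rewrite -/A -/B.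
move: Lh B1 B0; rewrite -(fineK fA) -(fineK fB) -(fineK fL) /=.
move: (fine (mu A)) (fine (mu B)) (fine (mu L)) => s p l.
rewrite -!EFinM -EFinD !lee_fin => l2 p1 p0 H.
have H1 : m ^+ 2 * (1 / 2) <= m ^+ 2 * l by rewrite ler_wpM2l ?sqr_ge0.
have H2 : p * m ^+ 2 <= 1 * m ^+ 2 by rewrite ler_wpM2r ?sqr_ge0.
suff H3 : 2 * Cp * p <= m ^+ 2 / 2 + b ^+ 2 * p.
  have : Cp * (2 * p) <= Cp * s by lra.
  by rewrite ler_pM2l //; lra.
have hp : 2 * Cp * p = p * (h ^+ 2 / 4) by rewrite h2; field.
rewrite hp.
have [hm|hm] := leP (h - m) 0.
  rewrite /b max_r // expr0n mul0r addr0.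
  have : p * h ^+ 2 <= 1 * h ^+ 2 by rewrite ler_wpM2r ?sqr_ge0.
  have : h ^+ 2 <= m ^+ 2 by rewrite ler_sqr ?nnegrE; lra.
  by have := sqr_ge0 h; lra.
rewrite /b max_l; last exact: ltW.
(* Completing the square, m^2/2 + (h - m)^2 = 3/2 (m - 2h/3)^2 + h^2/3, which is at least h^2/4 = 2
   Cp; and m^2 >= p m^2 as p <= 1. *)
have : 0 <= p * (m - 2 / 3 * h) ^+ 2 by rewrite mulr_ge0 // sqr_ge0.
have : 0 <= p * h ^+ 2 by rewrite mulr_ge0 // sqr_ge0.
lra.
Qed.

(** * From (tau) to the Poincare inequality for nonnegative functions *)

Lemma limn_einf_le_bound (R : realType) (u : (\bar R)^nat) (B : \bar R) :
  (forall n, u n <= B)%E -> (limn_einf u <= B)%E.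
Proof.
move=> uB; rewrite limn_einf_lim; apply: lime_le; first exact: is_cvg_einfs.
apply: nearW => n; apply: le_trans (uB n); apply: ereal_inf_lbound.
by exists n => /=.
Qed.

Section TauToPoincare.
Context {R : realType} (mu : probability R R) (C : R).
Hypotheses (C0 : 0 < C) (tau : convex_tau mu C).

Let mexp (u : R -> R) : measurable_fun setT u -> measurable_fun setT (fun x => expR (u x)).
Proof. by move=> mu'; apply: (measurableT_comp (@measurable_expR R)). Qed.

Section Nonnegative.
Variables (f p : R -> R) (M : R).
Hypotheses (cf : convex_fun f) (f0 : forall x, 0 <= f x).
Hypotheses (mp : measurable_fun setT p) (pM : forall x, `|p x| <= M).
Hypothesis sub : forall x y, f x + p x * (y - x) <= f y.

Let mf : measurable_fun setT f. Proof. exact: convex_measurable. Qed.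
Let G (x : R) : R := C ^+ 2 * p x ^+ 2 / 2.
Let K : R := C ^+ 2 * M ^+ 2 / 2.
Let G_ge0 x : 0 <= G x.
Proof. by rewrite /G divr_ge0 // mulr_ge0 // sqr_ge0. Qed.
Let M0 : 0 <= M. Proof. exact: le_trans (pM 0). Qed.
Let G_le x : G x <= K.
Proof.
rewrite /G /K ler_wpM2r // ler_wpM2l ?sqr_ge0 //.
by rewrite -[leLHS]real_normK ?num_real // ler_sqr ?nnegrE.
Qed.
Let mG : measurable_fun setT G.
Proof.
apply: measurable_funM; last exact: measurable_cst.
by apply: measurable_funM; [exact: measurable_cst | exact: measurable_funX].
Qed.

Let A t := (\int[mu]_x (expR (t * f x))%:E)%E.
Let B t := (\int[mu]_x (expR (- (t * f x)))%:E)%E.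

Let mtf t : measurable_fun setT (fun x => t * f x).
Proof. by apply: measurable_funM => //; exact: measurable_cst. Qed.
Let mtfN t : measurable_fun setT (fun x => - (t * f x)).
Proof. exact: (measurableT_comp (@oppr_measurable R setT)). Qed.

Let B_le1 t : 0 <= t -> (B t <= 1)%E.
Proof.
move=> t0; rewrite -(mean_cst mu 1); apply: mean_le.
- by move=> x; exact: expR_ge0.
- exact: mexp.
- exact: measurable_cst.
- by move=> x; rewrite -expR0 ler_expR oppr_le0 mulr_ge0.
Qed.

Let B_fin t : 0 <= t -> B t \is a fin_num.
Proof.
move=> t0; rewrite ge0_fin_numE; last by apply: mean_ge0 => x; exact: expR_ge0.
exact: le_lt_trans (B_le1 t t0) (ltry _).
Qed.

Let B_gt0 t : (0 < B t)%E.
Proof.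
have B0 : (0 <= B t)%E by apply: mean_ge0 => x; exact: expR_ge0.
rewrite lt_neqAle B0 andbT; apply/eqP => E.
have /ae_eq_integral_abs : measurable_fun setT (fun x => (expR (- (t * f x)))%:E).
  by apply/measurable_EFinP; exact: mexp.
move=> /(_ mu measurableT) [+ _].
have -> : (\int[mu]_x `|(expR (- (t * f x)))%:E| = 0)%E.
  rewrite E; apply: eq_integral => x _.
  by rewrite gee0_abs // lee_fin expR_ge0.
move=> /(_ erefl) [N [mN N0 NT]].
have : (mu setT <= mu N)%E.
  rewrite le_measure ?inE //; apply: subset_trans NT => x _ /= /(_ I) [] /eqP.
  by rewrite gt_eqF // expR_gt0.
by rewrite N0 probability_setT lee_fin ler10.
Qed.

(** Young's inequality with s = t p(x) C cancels the linear term of the subgradient bound, so the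
    infimum convolution of t f is at least t f - t^2 G. The smallness of t gives |s| <= 1. *)
Let tau_t t : 0 < t -> t * C * M <= 1 ->
  ((\int[mu]_x (expR (t * f x - t ^+ 2 * G x))%:E) * B t <= 1)%E.
Proof.
move=> t0 tM.
have ctf : convex_fun (fun x => t * f x).
  move=> x y s s01; have := cf x y s s01; rewrite -(ler_pM2l t0); lra.
have btf : has_lbound (range (fun x => t * f x)).
  by exists 0 => _ [x _ <-]; rewrite mulr_ge0 // ltW.
apply: le_trans (tau _ ctf btf); apply: lee_wpmul2r; first exact: ltW.
apply: mean_le.
- by move=> x; exact: expR_ge0.
- by apply: mexp; apply: measurable_funB => //; apply: measurable_funM => //; exact: measurable_cst.
- by apply: mexp; apply: convex_measurable; exact: inf_conv_convex.
move=> x; rewrite ler_expR; apply: inf_conv_ge => // y.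
have s1 : `|t * p x * C| <= 1.
  rewrite !normrM (gtr0_norm t0) (gtr0_norm C0) mulrAC; apply: le_trans tM.
  by apply: ler_wpM2l => //; rewrite mulr_ge0 // ltW.
have := phi0_young (t * p x * C) ((x - y) / C) s1.
have -> : t * p x * C * ((x - y) / C) = t * p x * (x - y) by field; rewrite gt_eqF.
have -> : (t * p x * C) ^+ 2 / 2 = t ^+ 2 * G x by rewrite /G; field.
have := sub x y; rewrite -(ler_pM2l t0); lra.
Qed.

(** As B > 0, the product bound of [tau_t] forces its other factor to be finite; boundedness of G
    then yields the exponential moment of f. *)
Let A_fin t : 0 < t -> t * C * M <= 1 -> A t \is a fin_num.
Proof.
move=> t0 tM.
have mE : measurable_fun setT (fun x => expR (t * f x - t ^+ 2 * G x)).
  by apply: mexp; apply: measurable_funB => //; apply: measurable_funM => //; exact: measurable_cst.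
have Efin : (\int[mu]_x (expR (t * f x - t ^+ 2 * G x))%:E)%E \is a fin_num.
  rewrite ge0_fin_numE; last by apply: mean_ge0 => x; exact: expR_ge0.
  rewrite ltNge leye_eq; apply/negP => /eqP E; have := tau_t t t0 tM.
  by rewrite E gt0_mulye ?B_gt0 // leye_eq.
rewrite ge0_fin_numE; last by apply: mean_ge0 => x; exact: expR_ge0.
apply: (@le_lt_trans _ _ ((expR (t ^+ 2 * K))%:E *
  \int[mu]_x (expR (t * f x - t ^+ 2 * G x))%:E)%E); last first.
  by rewrite -(fineK Efin) -EFinM ltry.
rewrite -meanZ ?expR_ge0 //.
apply: mean_le.
- by move=> x; exact: expR_ge0.
- exact: mexp.
- by apply: measurable_funM => //; exact: measurable_cst.
- move=> x; rewrite -expRD ler_expR.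
  have : t ^+ 2 * G x <= t ^+ 2 * K by rewrite ler_wpM2l ?sqr_ge0.
  lra.
Qed.

Lemma tau_integrable t : 0 < t -> t * C * M <= 1 ->
  mu.-integrable setT (fun x => (f x)%:E).
Proof.
move=> t0 tM; apply/integrableP; split; first exact/measurable_EFinP.
have -> : (\int[mu]_x `|(f x)%:E| = \int[mu]_x (f x)%:E)%E.
  by apply: eq_integral => x _; rewrite gee0_abs // lee_fin.
apply: (@le_lt_trans _ _ (t^-1%:E * A t)%E); last first.
  by rewrite -(fineK (A_fin t t0 tM)) -EFinM ltry.
have ti0 : 0 <= t^-1 by rewrite invr_ge0 ltW.
rewrite -meanZ //; last exact: mexp.
apply: mean_le => //.
  by apply: measurable_funM; [exact: measurable_cst | exact: mexp].
move=> x; rewrite mulrC ler_pdivlMr //.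
have := expR_ge1Dx (t * f x); lra.
Qed.

Let m := fine (\int[mu]_x (f x)%:E)%E.
Let V := (\int[mu]_x ((f x - m) ^+ 2)%:E)%E.

Let mV : measurable_fun setT (fun x => (f x - m) ^+ 2).
Proof. by apply: measurable_funX; apply: measurable_funB => //; exact: measurable_cst. Qed.

(* With a = E e^{t(f-m)} >= 1 and b = E e^{-t(f-m)} >= 1, ab >= a + b - 1. *)
Let var_le_exp t : 0 < t -> t * C * M <= 1 ->
  (1 + (t ^+ 2)%:E * V <= A t * B t)%E.
Proof.
move=> t0 tM; have mE : (\int[mu]_x (f x)%:E = m%:E)%E.
  by rewrite /m fineK //; apply: integrable_fin_num => //; exact: tau_integrable tM.
have m0 : 0 <= m by rewrite -lee_fin -mE mean_ge0.
have Afin := A_fin t t0 tM; have Bfin := B_fin t (ltW t0).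
pose U x := expR (t * (f x - m)); pose W x := expR (- (t * (f x - m))).
have U0 x : 0 <= U x by exact: expR_ge0.
have W0 x : 0 <= W x by exact: expR_ge0.
have mu1 : measurable_fun setT (fun x => t * (f x - m)).
  apply: measurable_funM; first exact: measurable_cst.
  by apply: measurable_funB => //; exact: measurable_cst.
have mU : measurable_fun setT U by exact: mexp.
have mW : measurable_fun setT W.
  by apply: mexp; exact: (measurableT_comp (@oppr_measurable R setT)).
have UE : (\int[mu]_x (U x)%:E = (expR (- (t * m)) * fine (A t))%:E)%E.
  rewrite EFinM fineK // -meanZ ?expR_ge0 //; last exact: mexp.
  by apply: eq_integral => x _; rewrite -expRD /U; congr (expR _)%:E; ring.
have WE : (\int[mu]_x (W x)%:E = (expR (t * m) * fine (B t))%:E)%E.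
  rewrite EFinM fineK // -meanZ ?expR_ge0 //; last exact: mexp.
  by apply: eq_integral => x _; rewrite -expRD /W; congr (expR _)%:E; ring.
have tf0 x : 0 <= t * f x by rewrite mulr_ge0 // ltW.
have tE : (\int[mu]_x (t * f x)%:E = (t * m)%:E)%E.
  by rewrite meanZ ?(ltW t0) // mE.
have a1 : 1 <= expR (- (t * m)) * fine (A t).
  (* The inequality e^u >= 1 + u is rearranged so that every term is nonnegative, as [meanD]
     requires. *)
  have : (1%:E + \int[mu]_x (t * f x)%:E <= \int[mu]_x (U x)%:E + (t * m)%:E)%E.
    rewrite -(mean_cst mu 1) -(mean_cst mu (t * m)).
    have tm0 : 0 <= t * m by rewrite mulr_ge0 // ltW.
    rewrite -(meanD mu (fun=> 1) (fun x => t * f x)) // -(meanD mu U (fun=> t * m)) //.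
    apply: mean_le.
    - by move=> x; rewrite addr_ge0.
    - by apply: measurable_funD => //; exact: measurable_cst.
    - by apply: measurable_funD => //; exact: measurable_cst.
    - by move=> x; have := expR_ge1Dx (t * (f x - m)); rewrite /U; lra.
  by rewrite UE tE -!EFinD lee_fin; lra.
have b1 : 1 <= expR (t * m) * fine (B t).
  have : (1%:E + (t * m)%:E <= \int[mu]_x (W x)%:E + \int[mu]_x (t * f x)%:E)%E.
    rewrite -(mean_cst mu 1) -(mean_cst mu (t * m)).
    have tm0 : 0 <= t * m by rewrite mulr_ge0 // ltW.
    rewrite -(meanD mu (fun=> 1) (fun=> t * m)) // -(meanD mu W (fun x => t * f x)) //.
    apply: mean_le.
    - by move=> x; rewrite addr_ge0 // mulr_ge0 // ltW.
    - by apply: measurable_funD => //; exact: measurable_cst.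
    - by apply: measurable_funD => //; exact: measurable_cst.
    - by move=> x; have := expR_ge1Dx (- (t * (f x - m))); rewrite /W; lra.
  by rewrite WE tE -!EFinD lee_fin; lra.
have ab : (2%:E + (t ^+ 2)%:E * V <= \int[mu]_x (U x)%:E + \int[mu]_x (W x)%:E)%E.
  have m2 : measurable_fun setT (fun x => t ^+ 2 * (f x - m) ^+ 2).
    by apply: measurable_funM => //; exact: measurable_cst.
  have n2 x : 0 <= t ^+ 2 * (f x - m) ^+ 2 by rewrite mulr_ge0 ?sqr_ge0.
  rewrite -meanZ ?sqr_ge0 //; last by move=> x; exact: sqr_ge0.
  rewrite -(mean_cst mu 2) -meanD // -meanD //.
  apply: mean_le.
  - by move=> x; rewrite addr_ge0.
  - by apply: measurable_funD => //; exact: measurable_cst.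
  - exact: measurable_funD.
  - move=> x; have := sqr_le_cosh2 (t * (f x - m)); rewrite exprMn /cosh2 /U /W; lra.
move: ab; rewrite UE WE -EFinD => ab.
have E1 : (A t * B t)%E = ((expR (- (t * m)) * fine (A t)) * (expR (t * m) * fine (B t)))%:E.
  by rewrite mulrACA [expR (- _) * _]mulrC expRxMexpNx_1 mul1r EFinM !fineK.
rewrite E1; move: a1 b1 ab; set a := expR _ * _; set b := expR _ * _ => a1 b1.
have V0 : (0 <= V)%E by apply: mean_ge0 => x; exact: sqr_ge0.
case: V V0 => [v| |] //=; last first.
  by move=> _; rewrite gt0_muley ?lte_fin ?exprn_gt0 //= leye_eq.
move=> _; rewrite -EFinM -!EFinD !lee_fin => ab.
have : 0 <= (a - 1) * (b - 1) by rewrite mulr_ge0 // subr_ge0.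
lra.
Qed.

(** From e^(-u) >= 1 - u, A <= Z + t^2 Y. Multiplying by B <= 1 and using Z B <= 1 gives 1 + t^2 V
    <= A B <= 1 + t^2 Y. *)
Let var_le t : 0 < t -> t * C * M <= 1 ->
  (V <= \int[mu]_x (expR (t * f x) * G x)%:E)%E.
Proof.
move=> t0 tM.
have Afin := A_fin t t0 tM; have Bfin := B_fin t (ltW t0).
have n1 x : 0 <= expR (t * f x) * G x by rewrite mulr_ge0 ?expR_ge0.
have m1 : measurable_fun setT (fun x => expR (t * f x) * G x).
  by apply: measurable_funM => //; exact: mexp.
set Y := (X in (V <= X)%E).
have Yfin : Y \is a fin_num.
  rewrite ge0_fin_numE ?mean_ge0 //.
  apply: (@le_lt_trans _ _ (K%:E * A t)%E); last by rewrite -(fineK Afin) -EFinM ltry.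
  rewrite -meanZ //; last 2 first.
  - exact: le_trans (G_le 0).
  - exact: mexp.
  apply: mean_le => //.
    by apply: measurable_funM; [exact: measurable_cst | exact: mexp].
  by move=> x; rewrite mulrC ler_wpM2r ?expR_ge0.
set Z := (\int[mu]_x (expR (t * f x - t ^+ 2 * G x))%:E)%E.
have Zfin : Z \is a fin_num.
  rewrite ge0_fin_numE; last by apply: mean_ge0 => x; exact: expR_ge0.
  apply: (@le_lt_trans _ _ (A t)); last by rewrite -(fineK Afin) ltry.
  apply: mean_le.
  - by move=> x; exact: expR_ge0.
  - by apply: mexp; apply: measurable_funB => //; apply: measurable_funM => //; exact: measurable_cst.
  - exact: mexp.
  - by move=> x; rewrite ler_expR lerBlDr lerDl mulr_ge0 ?sqr_ge0.
have AZ : (A t <= Z + (t ^+ 2)%:E * Y)%E.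
  rewrite -meanZ ?sqr_ge0 // -meanD; last 4 first.
  - by move=> x; exact: expR_ge0.
  - by apply: mexp; apply: measurable_funB => //; apply: measurable_funM => //; exact: measurable_cst.
  - by move=> x; rewrite mulr_ge0 ?sqr_ge0.
  - by apply: measurable_funM => //; exact: measurable_cst.
  apply: mean_le.
  - by move=> x; exact: expR_ge0.
  - exact: mexp.
  - apply: measurable_funD; last by apply: measurable_funM => //; exact: measurable_cst.
    by apply: mexp; apply: measurable_funB => //; apply: measurable_funM => //; exact: measurable_cst.
  - move=> x; rewrite expRD.
    have : expR (t * f x) * (1 - t ^+ 2 * G x) <= expR (t * f x) * expR (- (t ^+ 2 * G x)).
      rewrite ler_wpM2l ?expR_ge0 //; have := expR_ge1Dx (- (t ^+ 2 * G x)); lra.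
    lra.
have := var_le_exp t t0 tM; have := tau_t t t0 tM; have := B_le1 t (ltW t0).
have := B_gt0 t; rewrite -/Z.
have V0 : (0 <= V)%E by apply: mean_ge0 => x; exact: sqr_ge0.
have Y0 : 0 <= fine Y by rewrite fine_ge0 // mean_ge0.
move: AZ; rewrite -(fineK Afin) -(fineK Bfin) -(fineK Zfin) -(fineK Yfin).
case: V V0 => [v| |] //=; last first.
  by move=> _ _ _ _ _; rewrite gt0_muley ?lte_fin ?exprn_gt0.
move=> _; rewrite -?EFinM -?EFinD -?EFinM !lee_fin lte_fin.
set a := fine (A t); set b := fine (B t); set z := fine Z; set y := fine Y in Y0 *.
move=> az b0 b1 zb vab.
have t2 : 0 < t ^+ 2 by rewrite exprn_gt0.
rewrite -(ler_pM2l t2).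
have : a * b <= (z + t ^+ 2 * y) * b by rewrite ler_pM2r.
have : t ^+ 2 * y * b <= t ^+ 2 * y * 1 by rewrite ler_wpM2l // mulr_ge0 // ltW.
lra.
Qed.

Lemma tau_var_le : (V <= (C ^+ 2 / 2)%:E * \int[mu]_x (p x ^+ 2)%:E)%E.
Proof.
have M10 : 0 < C * (M + 1) by rewrite mulr_gt0 // ltr_wpDl.
(* M + 1 instead of M keeps the inverse well defined when M = 0. *)
pose t0 : R := (C * (M + 1))^-1.
have t00 : 0 < t0 by rewrite invr_gt0.
pose t (n : nat) : R := t0 / n.+1%:R.
have tn0 n : 0 < t n by rewrite divr_gt0.
have tnt0 n : t n <= t0.
  by rewrite /t ler_pdivrMr //; apply: ler_peMr; [exact: ltW | rewrite ler1n].
have small s : 0 < s -> s <= t0 -> s * C * M <= 1.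
  move=> s0 st; apply: (@le_trans _ _ (t0 * (C * (M + 1)))); last first.
    by rewrite /t0 mulVf // gt_eqF.
  rewrite -mulrA; apply: ler_pM => //; first exact: ltW.
    by rewrite mulr_ge0 // ltW.
  by rewrite ler_pM2l // lerDl.
have -> : ((C ^+ 2 / 2)%:E * \int[mu]_x (p x ^+ 2)%:E = \int[mu]_x (G x)%:E)%E.
  rewrite -meanZ ?divr_ge0 ?sqr_ge0 //; last 2 first.
  - by move=> x; exact: sqr_ge0.
  - exact: measurable_funX.
  by apply: eq_integral => x _; congr (_)%:E; rewrite /G; ring.
have t_cvg : t n @[n --> \oo] --> (0 : R).
  rewrite -[X in _ --> X](mulr0 t0); apply: cvgM; first exact: cvg_cst.
  exact: cvg_harmonic.
have cv : (\int[mu]_x (expR (t n * f x) * G x)%:E @[n --> \oo] --> \int[mu]_x (G x)%:E)%E.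
  (* The dominating function is integrable by the exponential moment at [t0], the largest of the
     parameters. *)
  have Kint : mu.-integrable setT (fun x => (K * expR (t0 * f x))%:E).
    apply/integrableP; split.
      by apply/measurable_EFinP; apply: measurable_funM; [exact: measurable_cst | exact: mexp].
    have K0 : 0 <= K by exact: le_trans (G_le 0).
    have -> : (\int[mu]_x `|(K * expR (t0 * f x))%:E| = K%:E * A t0)%E.
      rewrite -meanZ //; last exact: mexp.
      by apply: eq_integral => x _; rewrite gee0_abs // lee_fin mulr_ge0 ?expR_ge0.
    by rewrite -(fineK (A_fin t0 t00 (small _ t00 (lexx _)))) -EFinM ltry.
  have [] := @dominated_convergence _ _ _ mu setT measurableT
    (fun n x => (expR (t n * f x) * G x)%:E) (fun x => (G x)%:E)
    (fun x => (K * expR (t0 * f x))%:E).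
  - by move=> n; apply/measurable_EFinP; apply: measurable_funM => //; exact: mexp.
  - exact/measurable_EFinP.
  - apply/aeW => x _; apply: cvg_EFin; first exact: nearW.
    rewrite -[X in _ --> X]mul1r; apply: cvgM; last exact: cvg_cst.
    have tf : t n * f x @[n --> \oo] --> (0 : R).
      by rewrite -[X in _ --> X](mul0r (f x)); apply: cvgM => //; exact: cvg_cst.
    by rewrite -expR0; apply: (cvg_comp _ _ tf); exact: continuous_expR.
  - exact: Kint.
  - apply/aeW => x n _; rewrite gee0_abs; last first.
      by rewrite lee_fin; apply: mulr_ge0 => //; exact: expR_ge0.
    rewrite lee_fin mulrC; apply: ler_pM; rewrite ?expR_ge0 //.
    by rewrite ler_expR; apply: ler_wpM2r.
  - by move=> _ _.
rewrite -(cvg_lim _ cv) //; apply: lime_ge; first by apply/cvg_ex; eexists; exact: cv.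
apply: nearW => n; apply: var_le => //; exact: small.
Qed.

End Nonnegative.
End TauToPoincare.

(** * Extension to all convex functions by truncation from below *)

Section TauToPoincareGeneral.
Context {R : realType} (mu : probability R R) (C : R).
Hypotheses (C0 : 0 < C) (tau : convex_tau mu C).

Lemma tau_integrable_norm : mu.-integrable setT (fun x : R => (`|x|)%:E).
Proof.
pose p (x : R) : R := if 0 <= x then 1 else -1.
apply: (@tau_integrable _ mu C C0 tau _ p 1 _ _ _ _ _ C^-1).
- move=> x y t /andP[t0 t1]; apply: (le_trans (ler_normD _ _)).
  by rewrite !normrM (ger0_norm t0) (@ger0_norm _ (1 - t)) // subr_ge0.
- by move=> x; exact: normr_ge0.
- apply: nondecreasing_measurable => // x y xy; rewrite /p.
  by do ?[case: ifPn]; rewrite -?ltNge; lra.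
- by move=> x; rewrite /p; case: ifP => _; rewrite ?normrN normr1.
- move=> x y; rewrite /p; have [x0|x0] := leP 0 x.
    by rewrite ger0_norm //; have := ler_norm y; lra.
  by rewrite ltr0_norm //; have := ler_norm (- y); rewrite normrN; lra.
- by rewrite invr_gt0.
- by rewrite mulVf ?mulr1 // gt_eqF.
Qed.

Lemma tau_integrable_lipschitz (f : R -> R) (M : R) : measurable_fun setT f ->
  (forall x y, `|f x - f y| <= M * `|x - y|) ->
  mu.-integrable setT (fun x => (f x)%:E).
Proof.
move=> mf lip; apply/integrableP; split; first exact/measurable_EFinP.
have M0 : 0 <= M by have := lip 1 0; rewrite subr0 normr1 mulr1; exact: le_trans.
have mn : measurable_fun setT (fun x : R => `|x|) by exact: normr_measurable.
have mMn : measurable_fun setT (fun x : R => M * `|x|).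
  by apply: measurable_funM => //; exact: measurable_cst.
have n0 x : 0 <= M * `|x| by rewrite mulr_ge0.
apply: (@le_lt_trans _ _ (\int[mu]_x (`|f 0| + M * `|x|)%:E)%E).
  apply: mean_le.
  - by move=> x; exact: normr_ge0.
  - by apply: (measurableT_comp (@normr_measurable R setT)).
  - by apply: measurable_funD => //; exact: measurable_cst.
  - move=> x; have := lip x 0; rewrite subr0.
    by have := ler_normD (f x - f 0) (f 0); rewrite subrK; lra.
rewrite (meanD mu (fun=> `|f 0|)) // mean_cst meanZ //.
by rewrite -(fineK (integrable_fin_num _ tau_integrable_norm)) // -EFinM -EFinD ltry.
Qed.

Variables (f : R -> R) (M : R).
Hypotheses (cf : convex_fun f) (fM : forall x, `|dlimsup f x| <= M).

Let p := dlimsup f.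
Let mf : measurable_fun setT f. Proof. exact: convex_measurable. Qed.
Let mp : measurable_fun setT p. Proof. exact: dlimsup_measurable. Qed.

Lemma tau_integrable_convex : mu.-integrable setT (fun x => (f x)%:E).
Proof.
apply: (@tau_integrable_lipschitz f M mf); apply: (@subgradient_lipschitz _ f p) => //.
by move=> x y; exact: dlimsup_subgradient.
Qed.

Let fn (n : nat) (x : R) : R := Num.max (f x) (- n%:R).
Let S (n : nat) := [set x : R | - n%:R < f x].
(** A subgradient of [fn n]: it is set to 0 where the truncation is active. Since |pn| <= |p|, the
    bound in [var_fn] is uniform in n. *)
Let pn (n : nat) (x : R) : R := p x * \1_(S n) x.
Let m := fine (\int[mu]_x (f x)%:E)%E.
Let mn (n : nat) := fine (\int[mu]_x (fn n x)%:E)%E.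

Let mfn n : measurable_fun setT (fn n).
Proof. by apply: measurable_maxr => //; exact: measurable_cst. Qed.

Let mpn n : measurable_fun setT (pn n).
Proof.
apply: measurable_funM => //; apply: measurable_indic.
rewrite [X in measurable X](_ : _ = setT `&` f @^-1` `]- n%:R, +oo[).
  by apply: mf => //; exact: measurable_itv.
by apply/seteqP; split => x /=; rewrite in_itv /= andbT //; case.
Qed.

Let fn_norm n x : `|fn n x| <= `|f x|.
Proof.
have n0 : (0 : R) <= n%:R by [].
rewrite /fn maxEle; case: ifPn => // H; rewrite normrN (ger0_norm n0) ler_normr.
by apply/orP; right; rewrite lerNr.
Qed.

Let fn_int n : mu.-integrable setT (fun x => (fn n x)%:E).
Proof.
apply: (le_integrable _ _ _ tau_integrable_convex) => //; first exact/measurable_EFinP.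
by move=> x _; rewrite lee_fin.
Qed.

Let fn_cvg x : fn n x @[n --> \oo] --> f x.
Proof.
apply: cvg_near_cst; near=> n; rewrite /fn max_l //.
rewrite lerNl; near: n; exact: nbhs_infty_ger.
Unshelve. all: by end_near. Qed.

Let mn_cvg : mn n @[n --> \oo] --> m.
Proof.
apply: fine_cvg; rewrite /m fineK; last exact: integrable_fin_num tau_integrable_convex.
have [] := @dominated_convergence _ _ _ mu setT measurableT
  (fun n x => (fn n x)%:E) (fun x => (f x)%:E) (fun x => `|(f x)%:E|%E).
- by move=> n; exact/measurable_EFinP.
- exact/measurable_EFinP.
- by apply/aeW => x _; apply: cvg_EFin; [exact: nearW | exact: fn_cvg].
- exact: integrable_abse tau_integrable_convex.
- by apply/aeW => x n _; rewrite lee_fin.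
- by move=> _ _.
Qed.

Let var_fn n : (\int[mu]_x ((fn n x - mn n) ^+ 2)%:E <=
  (C ^+ 2 / 2)%:E * \int[mu]_x (p x ^+ 2)%:E)%E.
Proof.
have n0 : (0 : R) <= n%:R by [].
have E : fine (\int[mu]_x (fn n x + n%:R)%:E)%E = mn n + n%:R.
  under eq_integral do rewrite EFinD.
  rewrite integralD //; last exact: finite_measure_integrable_cst.
  rewrite mean_cst fineD //; exact: integrable_fin_num.
have -> : (\int[mu]_x ((fn n x - mn n) ^+ 2)%:E = \int[mu]_x
    ((fn n x + n%:R - fine (\int[mu]_x (fn n x + n%:R)%:E)) ^+ 2)%:E)%E.
  by apply: eq_integral => x _; rewrite E; congr (_ ^+ 2)%:E; ring.
(* The nonnegative function fn + n has the same variance as fn. *)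
apply: le_trans (@tau_var_le _ mu C C0 tau _ (pn n) M _ _ _ _ _) _.
- move=> x y t t01; have := cf x y t t01; case/andP: t01 => t0 t1.
  rewrite -lerBrDr /fn ge_max => H; apply/andP; split.
    have : t * f x <= t * Num.max (f x) (- n%:R) by rewrite ler_wpM2l // le_max lexx.
    have : (1 - t) * f y <= (1 - t) * Num.max (f y) (- n%:R).
      by apply: ler_wpM2l; [lra | rewrite le_max lexx].
    lra.
  have : t * (- n%:R) <= t * Num.max (f x) (- n%:R).
    by rewrite ler_wpM2l // le_max lexx orbT.
  have : (1 - t) * (- n%:R) <= (1 - t) * Num.max (f y) (- n%:R).
    by apply: ler_wpM2l; [lra | rewrite le_max lexx orbT].
  lra.
- by move=> x; rewrite -lerBlDr sub0r /fn le_max lexx orbT.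
- exact: mpn.
- move=> x; rewrite /pn indicE; case: (x \in _); rewrite ?mulr1 ?mulr0 //.
  by rewrite normr0; apply: le_trans (fM 0).
- move=> x y; rewrite /pn indicE; have [xn|xn] := ltP (- n%:R) (f x).
    rewrite mem_set //= mulr1 /fn max_l; last exact: ltW.
    have := dlimsup_subgradient f x y cf.
    have : f y <= Num.max (f y) (- n%:R) by rewrite le_max lexx.
    by rewrite -/p; lra.
  rewrite memNset /=; last by rewrite /S /=; lra.
  rewrite mulr0 mul0r addr0 lerD2r /fn max_r //.
  by rewrite le_max lexx orbT.
apply: lee_wpmul2l; first by rewrite lee_fin divr_ge0 // sqr_ge0.
apply: mean_le.
- by move=> x; exact: sqr_ge0.
- exact: measurable_funX.
- exact: measurable_funX.
- move=> x; rewrite /pn indicE; case: (x \in _); rewrite ?mulr1 ?mulr0 //.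
  by rewrite expr0n sqr_ge0.
Qed.

(** Fatou's lemma suffices, because the bound on the truncated variances is the same for all n. *)
Lemma tau_var_convex : (\int[mu]_x ((f x - m) ^+ 2)%:E <=
  (C ^+ 2 / 2)%:E * \int[mu]_x (p x ^+ 2)%:E)%E.
Proof.
have H x : ((fn n x - mn n) ^+ 2)%:E @[n --> \oo] --> ((f x - m) ^+ 2)%:E.
  apply: cvg_EFin; first exact: nearW.
  rewrite expr2; under eq_fun do rewrite expr2.
  by apply: cvgM; apply: cvgB => //; exact: fn_cvg.
have -> : (\int[mu]_x ((f x - m) ^+ 2)%:E =
    \int[mu]_x limn_einf (fun n => ((fn n x - mn n) ^+ 2)%:E))%E.
  by apply: eq_integral => x _; rewrite (cvg_limn_einf_sup (H x)).1.
apply: le_trans (fatou _ _ _ _) (limn_einf_le_bound _ _ _ _) => //.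
- move=> n; apply/measurable_EFinP; apply: measurable_funX.
  by apply: measurable_funB => //; exact: measurable_cst.
- by move=> n x _; rewrite lee_fin sqr_ge0.
Qed.

End TauToPoincareGeneral.

Lemma convex_tau_poincare (R : realType) (mu : probability R R) (C : R) :
  0 < C -> convex_tau mu C -> convex_poincare mu (C ^+ 2 / 2).
Proof.
move=> C0 tau f cf [M fM]; rewrite /Var ifT; last first.
  by apply/asboolP; exact: (@tau_integrable_convex _ mu C C0 tau f M).
exact: (@tau_var_convex _ mu C C0 tau f M).
Qed.

Theorem theorem1p1 (R : realType) (mu : probability R R) :
  symmetric_measure mu ->
  ((exists h lam : R, 0 < h /\ 0 <= lam < 1 /\ classM h lam mu) <->
   (exists Cp : R, 0 < Cp /\ convex_poincare mu Cp)) /\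
  ((exists Cp : R, 0 < Cp /\ convex_poincare mu Cp) <->
   (exists Ct : R, 0 < Ct /\ convex_tau mu Ct)) /\
  (forall h lam : R, 0 < h -> 0 <= lam < 1 -> classM h lam mu ->
     convex_tau mu (17 * h / (1 - lam) ^+ 2)) /\
  (forall Ct : R, 0 < Ct -> convex_tau mu Ct ->
     convex_poincare mu (Ct ^+ 2 / 2)) /\
  (forall Cp : R, 0 < Cp -> convex_poincare mu Cp ->
     classM (Num.sqrt (8 * Cp)) (1 / 2) mu).
Proof.
move=> sym.
have ac h lam : 0 < h -> 0 <= lam < 1 -> classM h lam mu ->
  convex_tau mu (17 * h / (1 - lam) ^+ 2) := @classM_convex_tau R mu h lam.
have cb Ct : 0 < Ct -> convex_tau mu Ct -> convex_poincare mu (Ct ^+ 2 / 2) :=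
  @convex_tau_poincare R mu Ct.
have ba Cp : 0 < Cp -> convex_poincare mu Cp ->
  classM (Num.sqrt (8 * Cp)) (1 / 2) mu := @convex_poincare_classM R mu Cp sym.
have exac : (exists h lam, 0 < h /\ 0 <= lam < 1 /\ classM h lam mu) ->
    exists Ct, 0 < Ct /\ convex_tau mu Ct.
  move=> [h [lam [h0 [/[dup] /andP[_ lam1] lam01 muM]]]].
  exists (17 * h / (1 - lam) ^+ 2); split; last exact: ac.
  by rewrite divr_gt0 ?exprn_gt0 ?subr_gt0 // mulr_gt0.
have excb : (exists Ct, 0 < Ct /\ convex_tau mu Ct) ->
    exists Cp, 0 < Cp /\ convex_poincare mu Cp.
  move=> [Ct [Ct0 muT]]; exists (Ct ^+ 2 / 2); split; last exact: cb.
  by rewrite divr_gt0 // exprn_gt0.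
have exba : (exists Cp, 0 < Cp /\ convex_poincare mu Cp) ->
    exists h lam, 0 < h /\ 0 <= lam < 1 /\ classM h lam mu.
  move=> [Cp [Cp0 muP]]; exists (Num.sqrt (8 * Cp)), (1 / 2).
  split; first by rewrite sqrtr_gt0 mulr_gt0.
  by split; [lra | exact: ba].
(* Both equivalences are read off the cycle (a) => (c) => (b) => (a). *)
split; first by split=> [/exac/excb | /exba].
split; first by split=> [/exba/exac | /excb].
by split; [exact: ac | split; [exact: cb | exact: ba]].
Qed.
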